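(* Let $(M,H=E\oplus F)$ be a five-dimensional Legendrean contact manifold, let $\sigma$ be a scale (a nowhere vanishing section of $\Lambda^0[1,1]$), and let $(\nabla_A,\bar\nabla^A)$ be the associated preferred partial connection, with obstructions to integrability $\Pi_A$ and $\Sigma^A$ (all as defined in the context). Let $o_A\in\Gamma(E^*[2,-1])$ and $\iota^A\in\Gamma(E[-2,1])$ satisfy $o_A\iota^A=1$. Let $\mathcal S=\Lambda^0[0,1]\oplus\Lambda^0[1,0]$, identify $\bigodot^3\mathcal S=\Lambda^0[0,3]\oplus\Lambda^0[1,2]\oplus\Lambda^0[2,1]\oplus\Lambda^0[3,0]$, and equip $M$ with the $G_2$ contact structure given by the isomorphism $$\textstyle\bigodot^3\mathcal S\to E^*[2,2]\oplus E[1,1]=\Lambda^1_H[2,2],\qquad (x,y,z,w)\mapsto\Big(x\,o_A-\tfrac1{\sqrt3}\,y\,\iota_A,\ w\,\iota^A-\tfrac1{\sqrt3}\,z\,o^A\Big).$$ Then the (invariant) torsion of this $G_2$ contact structure vanishes if and only if the following eight quantities all vanish: $$\begin{aligned} \psi_0&=\Pi_A\iota^A,\\ \psi_1&=\Pi_Ao^A-\tfrac{2}{\sqrt3}\,\iota^A(\nabla_A\iota^B)\iota_B,\\ \psi_2&=\iota_A(\bar\nabla^Ao_B)o^B+o_A(\bar\nabla^Ao_B)\iota^B-\bar\nabla_Ao^A+2\,o_A(\bar\nabla^A\iota_B)o^B,\\ \psi_3&=\iota_A(\bar\nabla^A\iota_B)o^B+o_A(\bar\nabla^A\iota_B)\iota^B-\tfrac13\bar\nabla_A\iota^A+\tfrac23\,\iota_A(\bar\nabla^Ao_B)\iota^B+\tfrac{2}{\sqrt3}\,o^A(\nabla_Ao^B)o_B,\\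 \psi_4&=o^A(\nabla_Ao^B)\iota_B+\iota^A(\nabla_Ao^B)o_B-\tfrac13\nabla^Ao_A+\tfrac23\,o^A(\nabla_A\iota^B)o_B+\tfrac{2}{\sqrt3}\,\iota_A(\bar\nabla^A\iota_B)\iota^B,\\ \psi_5&=o^A(\nabla_A\iota^B)\iota_B+\iota^A(\nabla_A\iota^B)o_B-\nabla^A\iota_A+2\,\iota^A(\nabla_Ao^B)\iota_B,\\ \psi_6&=\Sigma^A\iota_A+\tfrac{2}{\sqrt3}\,o_A(\bar\nabla^Ao_B)o^B,\\ \psi_7&=\Sigma^Ao_A. \end{aligned}$$
   Context: Everything is smooth and real; a bundle and its sections are denoted alike. Contact geometry. $M$ is a 5-manifold with contact distribution $H\subset TM$ (rank 4), $L\subset\Lambda^1$ is the annihilator of $H$, $\Lambda^k_H=\Lambda^kH^*$. The Levi form is the injective bundle map $L\to\Lambda^2_H$, $\alpha\mapsto d\alpha|_H$, with nondegenerate values. $\Lambda^2_H=\Lambda^2_{H\perp}\oplus L$, with $\Lambda^2_{H\perp}$ the forms trace-free with respect to the Levi form. The Rumin operator $d_\perp:\Lambda^1_H\to\Lambda^2_{H\perp}$ is: lift $\omega$ to a 1-form $\tilde\omega$ on $M$, and project $d\tilde\omega|_H$ to $\Lambda^2_{H\perp}$. A partial connection on a vector bundle $V$ is a linear differential operator $\nabla_H:V\to\Lambda^1_H\otimes V$ with $\nabla_H(fs)=f\nabla_Hs+(df|_H)\otimes s$. For a partial connection on $\Lambda^1_H$, let $\nabla_\perp:\Lambda^1_H\to\Lambda^2_{H\perp}$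 be the composition of $\nabla_H$ with $\Lambda^1_H\otimes\Lambda^1_H\to\Lambda^2_H\to\Lambda^2_{H\perp}$; its partial torsion is the bundle homomorphism $\nabla_\perp-d_\perp$. Legendrean contact structure. A splitting $H=E\oplus F$ into rank 2 subbundles, each null for the Levi form, so that the Levi form gives a perfect pairing $E\otimes F\to L^*$. Orient the line bundles $\det E$, $\det F$, $L$ so that real powers make sense. The densities $\Lambda^0[u,v]$ ($u,v\in\mathbb R$, additive under tensor product) are normalised by $\det E=\Lambda^0[3,-1]$, $\det F=\Lambda^0[-1,3]$, $L=\Lambda^0[-1,-1]$; $V[u,v]$ means $V\otimes\Lambda^0[u,v]$. The Levi form identifies $F^*=E\otimes L=E[-1,-1]$, so $\Lambda^1_H=E^*\oplus E[-1,-1]$, with elements written $(\omega_A,\bar\omega^A)$, and $\Lambda^2_{H\perp}=\Lambda^2E^*\oplus(E^*\otimes E)_\circ[-1,-1]\oplus\Lambda^2E[-2,-2]$, where $(\Xi_A{}^B)_\circ=\Xi_A{}^B-\frac12\delta_A{}^B\Xi_C{}^C$. Spinor conventions. Let $\epsilon_{AB}$ be the skew form on $E$ given by the identification $\Lambda^2E^*=\Lambda^0[-3,1]$ (a tautological section of $\Lambda^2E^*[3,-1]$), and $\epsilon^{AB}$ its inverse, $\epsilon_{AB}\epsilon^{AC}=\delta_B{}^C$. Indices are moved by $\xi^A=\epsilon^{AB}\xi_B$, $\xi_B=\xi^A\epsilon_{AB}$. Preferred partial connection. Given a scale $\sigma$, there is a unique partial connection on $\Lambda^1_H$, compatible with the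 Legendrean structure (preserving $E^*\oplus F^*$ and the line subbundle $L\subset\Lambda^2_H$ given by the Levi form), such that the induced partial connection on $L=\Lambda^0[-1,-1]$ annihilates $\sigma^{-1}$ and such that $\nabla_\perp-d_\perp$ takes values in $\mathrm{Hom}(F^*,\Lambda^2E^* )\oplus\mathrm{Hom}(E^*,\Lambda^2F^* )$. Write $\nabla_A$ for its part differentiating along $E$ and $\bar\nabla^A$ (with values in $F^*\otimes\cdot=E[-1,-1]\otimes\cdot$) for its part along $F$; they act on all weighted bundles $E^*[u,v]$, $E[u,v]$ by the Leibniz rule and annihilate $\epsilon_{AB}$. Then (identifying $\Lambda^2E^*$ and $\Lambda^2E$ with line bundles by $\phi_{AB}=\phi\,\epsilon_{AB}$ and $\phi^{AB}=\phi\,\epsilon^{AB}$) $$d_\perp\begin{bmatrix}\sigma_A\\ \tau^A\end{bmatrix}=\begin{bmatrix}-\nabla^A\sigma_A+\Pi_A\tau^A\\ (\nabla_A\tau^B-\bar\nabla^B\sigma_A)_\circ\\ \bar\nabla_A\tau^A+\Sigma^A\sigma_A\end{bmatrix},$$ which defines the tensors $\Pi_A$, $\Sigma^A$ (the obstructions to integrability of $E$ and $F$). $G_2$ contact structures. A $G_2$ contact structure on a contact 5-manifold is a rank 2 bundle $\mathcal S$ with an isomorphism $\bigodot^3\mathcal S\cong\Lambda^1_H\otimes(\Lambda^2\mathcal S)^2$ that is Levi-compatible: the Levi form has image the summand $(\Lambda^2\mathcal S)^{-1}$ in $\Lambda^2_H=(\bigodot^4\mathcal S\otimes(\Lambda^2\mathcal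 S)^{-3})\oplus(\Lambda^2\mathcal S)^{-1}$. Here $\Lambda^2\mathcal S=\Lambda^0[1,1]$, and $\bigodot^3\mathcal S$ is identified with quadruples $(x,y,z,w)$ as coefficients of binary cubics, so that the cube of $(p,q)\in\mathcal S$ is $(p^3,3p^2q,3pq^2,q^3)$; the isomorphism in the claim is Levi-compatible. Any partial connection on $\mathcal S$ induces one on $\Lambda^1_H$, whose partial torsion lies in $\mathrm{Hom}(\Lambda^1_H,\Lambda^2_{H\perp})\cong\bigodot^3\mathcal S\otimes\bigodot^4\mathcal S\otimes(\Lambda^2\mathcal S)^{-4}\cong\bigoplus_{j=0}^{3}\bigodot^{7-2j}\mathcal S\otimes(\Lambda^2\mathcal S)^{j-4}$. Its component in $\bigodot^7\mathcal S\otimes(\Lambda^2\mathcal S)^{-4}$ is independent of the choice of partial connection on $\mathcal S$ and is called the torsion of the $G_2$ contact structure. *)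

(* Defs.v *)
From HB Require Import structures.
From mathcomp Require Import all_boot all_order all_algebra.
From mathcomp Require Import all_classical all_reals all_analysis.

Set Implicit Arguments.
Unset Strict Implicit.
Unset Printing Implicit Defensive.

Import Order.TTheory GRing.Theory Num.Theory.
Import numFieldNormedType.Exports.

Local Open Scope classical_set_scope.
Local Open Scope ring_scope.

Fixpoint Ck (R : realType) (k : nat) (U : set 'rV[R]_5) (f : 'rV[R]_5 -> R)
    : Prop :=
  (forall x, U x -> {for x, continuous f}) /\
  (if k is k'.+1 then
     forall v : 'rV[R]_5,
       (forall x, U x -> derivable f x v) /\ Ck k' U (fun x => 'D_v f x)
   else True).

Definition Cinfty (R : realType) (U : set 'rV[R]_5) (f : 'rV[R]_5 -> R) : Prop :=
  forall k, Ck k U f.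

Record chart (R : realType) (M : Type) := Chart {
  cdom : set M;
  cmap : M -> 'rV[R]_5;
  cinv : 'rV[R]_5 -> M }.

Definition is_chart (R : realType) (M : topologicalType) (c : chart R M) : Prop :=
  [/\ open (cdom c), open (cmap c @` cdom c),
      (forall x, cdom c x -> cinv c (cmap c x) = x),
      (forall x, cdom c x -> {for x, continuous (cmap c)})
    & (forall y, (cmap c @` cdom c) y -> {for y, continuous (cinv c)})].

Record manifold5 (R : realType) := Manifold5 {
  carrier :> topologicalType;
  atlas : set (chart R carrier);
  _ : hausdorff_space carrier;
  _ : @second_countable carrier;
  _ : forall c, atlas c -> is_chart c;
  _ : forall x, exists2 c, atlas c & cdom c x;
  _ : forall c c' (i : 'I_5), atlas c -> atlas c' ->
        Cinfty (cmap c @` (cdom c `&` cdom c'))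
               (fun y => cmap c' (cinv c y) 0 i) }.

Section Calculus.
Context {R : realType} {M : manifold5 R}.

Definition smooth_on (U : set M) (f : M -> R) : Prop :=
  forall c, atlas c -> Cinfty (cmap c @` (U `&` cdom c)) (f \o cinv c).

Definition smooth (f : M -> R) : Prop := smooth_on setT f.

(** Tangent vectors at [x] are the derivations at [x] of the algebra of smooth
    functions; they are extended by 0 to non-smooth functions, so that two
    tangent vectors agreeing on smooth functions are equal. *)
Definition tvec : Type := (M -> R) -> R.

Definition is_tangent (x : M) (v : tvec) : Prop :=
  [/\ forall f g, smooth f -> smooth g -> v (fun y => f y + g y) = v f + v g,
      forall (k : R) f, smooth f -> v (fun y => k * f y) = k * v f,
      forall f g, smooth f -> smooth g ->
        v (fun y => f y * g y) = f x * v g + g x * v f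
    & forall f, ~ smooth f -> v f = 0].

Definition tcomb (k : 'I_2 -> R) (e : 'I_2 -> tvec) : tvec :=
  fun f => \sum_i k i * e i f.

Definition smooth_vf (U : set M) (X : M -> tvec) : Prop :=
  (forall x, U x -> is_tangent x (X x)) /\
  (forall f, smooth f -> smooth_on U (fun x => X x f)).

Definition bracket (X Y : M -> tvec) : M -> tvec :=
  fun x f => X x (fun y => Y y f) - Y x (fun y => X y f).

Definition form1 : Type := M -> tvec -> R.

Definition smooth_form1 (w : form1) : Prop :=
  (forall x (k : R) u v, is_tangent x u -> is_tangent x v ->
     w x (fun f => k * u f + v f) = k * w x u + w x v) /\
  (forall U X, open U -> smooth_vf U X -> smooth_on U (fun x => w x (X x))).

(** A global vector field through a given tangent vector.  The choice is
    immaterial in [dform], whose value at [x] depends only on [u] and [v]. *)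
Definition extend (x : M) (u : tvec) : M -> tvec :=
  match pselect (exists X, smooth_vf setT X /\ X x = u) with
  | left h => projT1 (cid h)
  | right _ => fun _ _ => 0
  end.

(** Exterior derivative, dw(X,Y) = X w(Y) - Y w(X) - w([X,Y]), at a point. *)
Definition dform (w : form1) (x : M) (u v : tvec) : R :=
  let X := extend x u in
  let Y := extend x v in
  X x (fun y => w y (Y y)) - Y x (fun y => w y (X y)) - w x (bracket X Y x).

Definition is_basis2 (V : set tvec) (e : 'I_2 -> tvec) : Prop :=
  (forall v, V v <-> exists k, v = tcomb k e) /\
  (forall k, tcomb k e = (fun=> 0) -> forall i, k i = 0).

Definition rank2_subbundle (E : M -> set tvec) : Prop :=
  forall x, exists (U : set M) (X : 'I_2 -> M -> tvec),
    [/\ open U, U x, (forall i, smooth_vf U (X i))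
      & forall y, U y -> is_basis2 (E y) (fun i => X i y)].

End Calculus.
Arguments tvec {R} M.
Arguments form1 {R} M.

(** The orientations of [L] and of [det E] are given by nowhere vanishing
    sections [lam] and [vol] of [L] and [det E^*], of which only the classes up
    to positive multiples matter.  The identification [det F = (det E)^* L^-2]
    induced by the Levi form then orients [det F]. *)
Record legendrean (R : realType) (M : manifold5 R) := Legendrean {
  bE : M -> set (tvec M);
  bF : M -> set (tvec M);
  lam : form1 M;
  vol : M -> tvec M -> tvec M -> R;
  _ : rank2_subbundle bE;
  _ : rank2_subbundle bF;
  _ : forall x v, bE x v -> bF x v -> v = (fun=> 0);
  _ : smooth_form1 lam;
  (* the kernel H of lam is E + F *)
  _ : forall x w, (is_tangent x w /\ lam x w = 0) <->
        exists u v, [/\ bE x u, bF x v & w = (fun f => u f + v f)];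
  _ : forall x u, is_tangent x u -> lam x u = 0 ->
        (forall v, is_tangent x v -> lam x v = 0 -> dform lam x u v = 0) ->
        u = (fun=> 0);
  _ : forall x u v, bE x u -> bE x v -> dform lam x u v = 0;
  _ : forall x u v, bF x u -> bF x v -> dform lam x u v = 0;
  _ : forall x u v, bE x u -> bE x v -> vol x u v = - vol x v u;
  _ : forall x (k : R) u u' v, bE x u -> bE x u' -> bE x v ->
        vol x (fun f => k * u f + u' f) v = k * vol x u v + vol x u' v;
  _ : forall x (e : 'I_2 -> tvec M), is_basis2 (bE x) e ->
        vol x (e 0) (e 1) != 0;
  _ : forall (U : set M) X Y, open U -> smooth_vf U X -> smooth_vf U Y ->
        (forall x, U x -> bE x (X x) /\ bE x (Y x)) ->
        smooth_on U (fun x => vol x (X x) (Y x)) }.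

(** Indices for [H = E + F]: [inl A] is an index along [E], [inr A] along [F]. *)
Notation Hidx := ('I_2 + 'I_2)%type.

Definition kron (R : pzSemiRingType) (A B : 'I_2) : R := (A == B)%:R.
Arguments kron {R} A B.

Section Bundles.
Context {R : realType} {M : manifold5 R} (G : legendrean M).

(** An adapted frame at [base]: a positive basis [e_A] of [E], a positive
    element [fl * lam] of [L], and the basis [f^A] of [F] with
    [d(fl * lam)(e_A, f^B) = delta_A^B].  So [(e, fl)] determines [f], and the
    frame identifies [F^*] with [E] tensor [L] by the Levi form. *)
Record frame := Frame {
  base : M;
  fe : 'I_2 -> tvec M;
  ff : 'I_2 -> tvec M;
  fl : R;
  _ : is_basis2 (bE G base) fe;
  _ : is_basis2 (bF G base) ff;
  _ : 0 < fl;
  _ : vol G base (fe 0) (fe 1) > 0;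
  _ : forall A B, fl * dform (lam G) base (fe A) (ff B) = kron A B }.

Definition hv (p : frame) (a : Hidx) : tvec M :=
  match a with inl A => fe p A | inr A => ff p A end.

Definition smooth_frame (U : set M) (s : M -> frame) : Prop :=
  [/\ forall x, U x -> base (s x) = x,
      forall a, smooth_vf U (fun x => hv (s x) a)
    & smooth_on U (fun x => fl (s x))].

(** Weighted tensor bundles, as bundles associated to the bundle of adapted
    frames: [rho g t] is the matrix by which components change when the frame
    [e_A, fl] is replaced by [g_A^B e_B, t * fl] (with [det g > 0], [t > 0]). *)
Record bundle := Bundle {
  idx : finType;
  rho : 'M[R]_2 -> R -> idx -> idx -> R }.

Definition tfield (V : bundle) : Type := frame -> idx V -> R.

Definition is_section (V : bundle) (s : tfield V) : Prop :=
  (forall (p p' : frame) (g : 'M[R]_2), base p' = base p ->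
     (forall A, fe p' A = tcomb (g A) (fe p)) ->
     forall i, s p' i = \sum_j rho g (fl p' / fl p) i j * s p j) /\
  (forall (U : set M) (fr : M -> frame), open U -> smooth_frame U fr ->
     forall i, smooth_on U (fun x => s (fr x) i)).

(** The density weight [u,v]: with [det E = [3,-1]] and [L = [-1,-1]], one has
    [[u,v] = (det E)^((u-v)/4) L^(-(u+3v)/4)]. *)
Definition dweight (u v : R) (g : 'M[R]_2) (t : R) : R :=
  (\det g) `^ ((v - u) / 4) * t `^ ((u + 3 * v) / 4).

Definition wt (V : bundle) (u v : R) : bundle :=
  @Bundle (idx V) (fun g t i j => dweight u v g t * rho g t i j).

Definition Bdens (u v : R) : bundle :=
  @Bundle unit (fun g t _ _ => dweight u v g t).
Definition BEd : bundle := @Bundle 'I_2 (fun g _ A B => g A B).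
Definition BE : bundle := @Bundle 'I_2 (fun g _ A B => invmx g B A).

Definition Bsum (V W : bundle) : bundle :=
  @Bundle (idx V + idx W)%type
    (fun g t i j => match i, j with
                    | inl a, inl b => rho g t a b
                    | inr a, inr b => rho g t a b
                    | _, _ => 0
                    end).

Definition Btens (V W : bundle) : bundle :=
  @Bundle (idx V * idx W)%type
    (fun g t i j => rho g t i.1 j.1 * rho g t i.2 j.2).

(** [Lambda^1_H = E^* + E[-1,-1]]; the components of a section [w] are its
    values on the vectors of the frame. *)
Definition BL1H : bundle := Bsum (wt BEd 0 0) (wt BE (-1) (-1)).

(** [Sym^k S] for [S = [0,1] + [1,0]]; the [i]-th component, of weight
    [[i,k-i]], is the [i]-th coefficient of a binary form of degree [k]. *)
Definition BSymS (k : nat) : bundle :=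
  @Bundle 'I_k.+1
    (fun g t i j => (i == j)%:R * dweight i%:R (k%:R - i%:R) g t).
Definition BS : bundle := BSymS 1.

Definition partial_connection (V : bundle)
    (D : tfield V -> tfield (Btens BL1H V)) : Prop :=
  [/\ forall s, is_section s -> is_section (D s),
      forall s s', is_section s -> is_section s' -> forall p a i,
        D (fun q j => s q j + s' q j) p (a, i) = D s p (a, i) + D s' p (a, i)
    & forall (f : M -> R) s, smooth f -> is_section s -> forall p a i,
        D (fun q j => f (base q) * s q j) p (a, i) =
          f (base p) * D s p (a, i) + hv p a f * s p i].

Definition form2 : Type := Hidx -> Hidx -> R.

Definition wedge (w w' : Hidx -> R) : form2 :=
  fun a b => w a * w' b - w b * w' a.

(** Generator of [L] in [Lambda^2_H]: the Levi form of [fl * lam]. *)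
Definition levi : form2 :=
  fun a b => match a, b with
             | inl A, inr B => kron A B
             | inr A, inl B => - kron A B
             | _, _ => 0
             end.

(** Projection onto [Lambda^2_Hperp] along [L]. *)
Definition perp (W : form2) : form2 :=
  fun a b => W a b - (\sum_A W (inl A) (inr A)) / 2 * levi a b.

Definition is_lift (w : tfield BL1H) (w' : form1 M) : Prop :=
  smooth_form1 w' /\ forall p a, w' (base p) (hv p a) = w p a.

Definition lift (w : tfield BL1H) : form1 M :=
  match pselect (exists w', is_lift w w') with
  | left h => projT1 (cid h)
  | right _ => fun _ _ => 0
  end.

(** Rumin operator; two lifts differ by a multiple of [lam], so that the choice
    made in [lift] disappears after [perp]. *)
Definition d_perp (w : tfield BL1H) (p : frame) : form2 :=
  perp (fun a b => dform (lift w) (base p) (hv p a) (hv p b)).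

Definition nabla_perp (N : tfield BL1H -> tfield (Btens BL1H BL1H))
    (w : tfield BL1H) (p : frame) : form2 :=
  perp (fun a b => N w p (a, b) - N w p (b, a)).

(** [T p c a b] are the components of a homomorphism
    [Lambda^1_H -> Lambda^2_Hperp]. *)
Definition partial_torsion (N : tfield BL1H -> tfield (Btens BL1H BL1H))
    (T : frame -> Hidx -> form2) : Prop :=
  forall w : tfield BL1H, is_section w -> forall p (a b : Hidx),
    \sum_(c : Hidx) w p c * T p c a b = nabla_perp N w p a b - d_perp w p a b.

(** The connection induced by [N] on [Lambda^2_H] maps the section
    [l * levi] of [L] to [m_c * levi]; sections of [Lambda^2_H] are written as
    finite sums of wedge products. *)
Definition induced_on_L (N : tfield BL1H -> tfield (Btens BL1H BL1H))
    (l : tfield (Bdens (-1) (-1))) (m : frame -> Hidx -> R) : Prop :=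
  forall n (w w' : 'I_n -> tfield BL1H),
    (forall i, is_section (w i)) -> (forall i, is_section (w' i)) ->
    (forall p a b, \sum_i wedge (w i p) (w' i p) a b = l p tt * levi a b) ->
    forall p c a b,
      \sum_i (wedge (fun d => N (w i) p (c, d)) (w' i p) a b
              + wedge (w i p) (fun d => N (w' i) p (c, d)) a b)
      = m p c * levi a b.

Definition is_scale (sigma : tfield (Bdens 1 1)) : Prop :=
  is_section sigma /\ forall p, sigma p tt != 0.

Definition inE (w : tfield BL1H) : Prop := forall p A, w p (inr A) = 0.
Definition inF (w : tfield BL1H) : Prop := forall p A, w p (inl A) = 0.

Definition preferred (sigma : tfield (Bdens 1 1))
    (N : tfield BL1H -> tfield (Btens BL1H BL1H)) : Prop :=
  [/\ partial_connection N,
      (forall w : tfield BL1H, is_section w ->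
        (inE w -> forall p a B, N w p (a, inr B) = 0) /\
        (inF w -> forall p a B, N w p (a, inl B) = 0)),
      (forall l : tfield (Bdens (-1) (-1)), is_section l ->
         exists m, induced_on_L N l m),
      induced_on_L N (fun p i => (sigma p i)^-1) (fun _ _ => 0)
    & exists2 T, partial_torsion N T & forall p A B C,
        [/\ T p (inl C) (inl A) (inl B) = 0,
            T p (inr C) (inr A) (inr B) = 0
          & forall c, T p c (inl A) (inr B) = 0]].

(** In every adapted frame [epsilon_{12} = epsilon^{12} = 1]; the same matrix
    serves for [epsilon_{AB}] and [epsilon^{AB}]. *)
Definition eps (A B : 'I_2) : R := kron A 0 * kron B 1 - kron A 1 * kron B 0.

Definition raise (x : frame -> 'I_2 -> R) : frame -> 'I_2 -> R :=
  fun p A => \sum_B eps A B * x p B.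
Definition lower (x : frame -> 'I_2 -> R) : frame -> 'I_2 -> R :=
  fun p B => \sum_A x p A * eps A B.

(** The operators [(nabla_A, bar nabla^A)] on [[u,v]], [E^*[u,v]], [E[u,v]]. *)
Record weighted_ops := WeightedOps {
  n0 : forall u v, tfield (Bdens u v) -> tfield (Btens BL1H (Bdens u v));
  nd : forall u v, tfield (wt BEd u v) -> tfield (Btens BL1H (wt BEd u v));
  nu : forall u v, tfield (wt BE u v) -> tfield (Btens BL1H (wt BE u v)) }.

Arguments n0 : clear implicits.
Arguments nd : clear implicits.
Arguments nu : clear implicits.

(** Extension of a partial connection on [Lambda^1_H] to weighted bundles:
    Leibniz rule for products, contractions and real powers of positive
    densities, and [epsilon_{AB}] annihilated. *)
Definition weighted_extension
    (N : tfield BL1H -> tfield (Btens BL1H BL1H)) (D : weighted_ops) : Prop :=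
  (forall u v, [/\ partial_connection (n0 D u v), partial_connection (nd D u v)
                 & partial_connection (nu D u v)]) /\
  (forall w : tfield BL1H, is_section w -> forall p (a : Hidx) A,
     (N w p (a, inl A) = nd D 0 0 (fun q B => w q (inl B)) p (a, A)) /\
     (N w p (a, inr A) = nu D (-1) (-1) (fun q B => w q (inr B)) p (a, A))) /\
  (forall u v u' v' (f : tfield (Bdens u v)), is_section f ->
     (forall s : tfield (Bdens u' v'), is_section s -> forall p a,
        n0 D (u + u') (v + v') (fun q i => f q tt * s q i) p (a, tt) =
        f p tt * n0 D u' v' s p (a, tt) + n0 D u v f p (a, tt) * s p tt) /\
     (forall s : tfield (wt BEd u' v'), is_section s -> forall p a A,
        nd D (u + u') (v + v') (fun q i => f q tt * s q i) p (a, A) =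
        f p tt * nd D u' v' s p (a, A) + n0 D u v f p (a, tt) * s p A) /\
     (forall s : tfield (wt BE u' v'), is_section s -> forall p a A,
        nu D (u + u') (v + v') (fun q i => f q tt * s q i) p (a, A) =
        f p tt * nu D u' v' s p (a, A) + n0 D u v f p (a, tt) * s p A)) /\
  (forall u v u' v' (s : tfield (wt BEd u v)) (t : tfield (wt BE u' v')),
     is_section s -> is_section t -> forall p a,
     n0 D (u + u') (v + v') (fun q _ => \sum_A s q A * t q A) p (a, tt) =
     \sum_A (nd D u v s p (a, A) * t p A + s p A * nu D u' v' t p (a, A))) /\
  (forall u v r (f : tfield (Bdens u v)), is_section f ->
     (forall p, 0 < f p tt) -> forall p a,
     n0 D (r * u) (r * v) (fun q i => f q i `^ r) p (a, tt) =
     r * f p tt `^ (r - 1) * n0 D u v f p (a, tt)) /\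
  (forall u v (t : tfield (wt BE u v)), is_section t -> forall p a B,
     nd D (u + 3) (v - 1) (lower t) p (a, B) =
     \sum_A nu D u v t p (a, A) * eps A B).

(** [Pi_A] and [Sigma^A], defined by the formula for [d_perp]; the components
    of [phi epsilon_{AB}], [phi epsilon^{AB}] are [phi * eps A B]. *)
Definition obstructions (D : weighted_ops)
    (Pi : tfield (wt BEd (-2) 2)) (Sig : tfield (wt BE 1 (-3))) : Prop :=
  [/\ is_section Pi, is_section Sig &
   forall w : tfield BL1H, is_section w ->
   let s : tfield (wt BEd 0 0) := fun q B => w q (inl B) in
   let t : tfield (wt BE (-1) (-1)) := fun q B => w q (inr B) in
   forall p,
   let X A B := nd D 0 0 s p (inr B, A) in       (* bar nabla^B sigma_A *)
   let Y A B := nu D (-1) (-1) t p (inl A, B) in (* nabla_A tau^B *)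
   [/\ forall A B, d_perp w p (inl A) (inl B) =
         (- (\sum_C \sum_E eps C E * nd D 0 0 s p (inl E, C))
          + \sum_C Pi p C * t p C) * eps A B,
       forall A B, d_perp w p (inl A) (inr B) =
         (Y A B - X A B) - (\sum_C (Y C C - X C C)) / 2 * kron A B
     & forall A B, d_perp w p (inr A) (inr B) =
         ((\sum_C \sum_E eps E C * nu D (-1) (-1) t p (inr E, C))
          + \sum_C Sig p C * s p C) * eps A B]].

(** A binary form of degree [k], with coefficients [c_0, ..., c_k], is
    represented by the polynomial [\sum_i c_i X^i]: the symmetric product of
    forms is the product of polynomials. *)
Definition form_of (k : nat) (c : 'I_k.+1 -> R) : {poly R} :=
  \poly_(i < k.+1) (if insub i is Some j then c j else 0).

(** Components [J p i a] of a homomorphism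
    [Sym^3 S -> Lambda^1_H (Lambda^2 S)^2 = Lambda^1_H[2,2]]. *)
Definition g2map : Type := frame -> 'I_4 -> Hidx -> R.

Definition japp (J : g2map) (p : frame) (c : {poly R}) : Hidx -> R :=
  fun a => \sum_(i < 4) c`_i * J p i a.

(** The projection [Lambda^2_H -> Sym^4 S (Lambda^2 S)^-3] given by [J], which
    is induced from the first transvectant (Jacobian) of binary cubics; for
    cubics written as polynomials the latter is, up to a factor 3, [c d' - c' d].
    Here [Q p a b] are the components of a map on 2-forms. *)
Definition qapp (Q : frame -> Hidx -> Hidx -> {poly R}) (p : frame) (W : form2)
    : {poly R} := \sum_a \sum_b W a b *: Q p a b.

Definition sym4_projection (J : g2map)
    (Q : frame -> Hidx -> Hidx -> {poly R}) : Prop :=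
  forall p (c d : {poly R}), (size c <= 4)%N -> (size d <= 4)%N ->
    qapp Q p (wedge (japp J p c) (japp J p d)) = c * d^`() - c^`() * d.

(** The Levi form spans the other summand, which is the kernel of the
    projection to [Sym^4 S (Lambda^2 S)^-3]. *)
Definition G2_contact_structure (J : g2map) : Prop :=
  [/\ forall c : tfield (BSymS 3), is_section c ->
        @is_section (wt BL1H 2 2) (fun p a => \sum_i c p i * J p i a),
      forall p (w : Hidx -> R), exists! c : 'I_4 -> R,
        forall a, \sum_i c i * J p i a = w a
    & forall Q, sym4_projection J Q -> forall p, qapp Q p levi = 0].

(** [s /\ t] as a section of [Lambda^2 S = [1,1]]. *)
Definition wedgeS (s t : 'I_2 -> R) : R := s 0 * t 1 - s 1 * t 0.

(** [K] is the partial connection on [Lambda^1_H = Sym^3 S (Lambda^2 S)^-2]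
    induced by [D] on [S]: whenever [J (s1 s2 s3) = w (t1 /\ t2)^2], the
    covariant derivatives of both sides correspond. *)
Definition induced_by_S (J : g2map)
    (D : tfield BS -> tfield (Btens BL1H BS))
    (K : tfield BL1H -> tfield (Btens BL1H BL1H)) : Prop :=
  partial_connection K /\
  forall (s1 s2 s3 t1 t2 : tfield BS) (w : tfield BL1H),
    is_section s1 -> is_section s2 -> is_section s3 ->
    is_section t1 -> is_section t2 -> is_section w ->
    let f (s : tfield BS) p := @form_of 1 (s p) in
    let Df (s : tfield BS) p a := @form_of 1 (fun i => D s p (a, i)) in
    (forall p b, japp J p (f s1 p * f s2 p * f s3 p) b =
                 w p b * wedgeS (t1 p) (t2 p) ^+ 2) ->
    forall p a b,
      japp J p (Df s1 p a * f s2 p * f s3 p + f s1 p * Df s2 p a * f s3 p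
                + f s1 p * f s2 p * Df s3 p a) b =
      K w p (a, b) * wedgeS (t1 p) (t2 p) ^+ 2
      + w p b * (2 * wedgeS (t1 p) (t2 p)
                 * (wedgeS (fun i => D t1 p (a, i)) (t2 p)
                    + wedgeS (t1 p) (fun i => D t2 p (a, i)))).

(** [sym7 q] is the image of a homomorphism [q : Sym^3 S -> Sym^4 S] in
    [Sym^7 S]: with [S^* = S (Lambda^2 S)^-1], it is [\sum_i c_i (q X^i)] where
    the cubic [c_i] represents the [i]-th coordinate through the invariant
    pairing [x w' - y z' / 3 + z y' / 3 - w x'] of cubics. *)
Definition sym7 (q : {poly R} -> {poly R}) : {poly R} :=
  q 'X^3 - 3 *: 'X * q 'X^2 + 3 *: 'X^2 * q 'X - 'X^3 * q 1.

(** [theta] is the torsion of [J]: the [Sym^7 S (Lambda^2 S)^-4] component of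
    the partial torsion of the partial connection on [Lambda^1_H] induced by
    some partial connection on [S]. *)
Definition G2_torsion (J : g2map) (theta : frame -> {poly R}) : Prop :=
  G2_contact_structure J /\
  exists (D : tfield BS -> tfield (Btens BL1H BS))
         (K : tfield BL1H -> tfield (Btens BL1H BL1H))
         (T : frame -> Hidx -> form2)
         (Q : frame -> Hidx -> Hidx -> {poly R}),
    [/\ partial_connection D, induced_by_S J D K, partial_torsion K T,
        sym4_projection J Q
      & forall p, theta p =
          sym7 (fun c => qapp Q p
                  (fun a b => \sum_d japp J p c d * T p d a b))].

(** [(x,y,z,w) |-> (x o_A - y iota_A / sqrt 3, w iota^A - z o^A / sqrt 3)], by its values on the
    four coordinate vectors. *)
Definition spinor_g2map (o iota : frame -> 'I_2 -> R) : g2map :=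
  fun p i a =>
    match a with
    | inl A => [:: o p A; - (lower iota p A / Num.sqrt 3); 0; 0]`_i
    | inr A => [:: 0; 0; - (raise o p A / Num.sqrt 3); iota p A]`_i
    end.

Section Psi.
Context (D : weighted_ops) (Pi : tfield (wt BEd (-2) 2))
  (Sig : tfield (wt BE 1 (-3))) (o : tfield (wt BEd 2 (-1)))
  (iota : tfield (wt BE (-2) 1)) (p : frame).

Local Notation sq3 := (Num.sqrt (3 : R)).

(* [oU] is [o^A] and [iL] is [iota_A]; the matrices [n_x], [b_x] are
   [nabla_A x], [bar nabla^A x] with [A] first. *)
Let oU : tfield (wt BE (-1) 0) := raise o.
Let iL : tfield (wt BEd 1 0) := lower iota.

Let n_o A B := nd D 2 (-1) o p (inl A, B).
Let n_oU A B := nu D (-1) 0 oU p (inl A, B).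
Let n_i A B := nu D (-2) 1 iota p (inl A, B).
Let n_iL A B := nd D 1 0 iL p (inl A, B).
Let b_o A B := nd D 2 (-1) o p (inr A, B).
Let b_oU A B := nu D (-1) 0 oU p (inr A, B).
Let b_i A B := nu D (-2) 1 iota p (inr A, B).
Let b_iL A B := nd D 1 0 iL p (inr A, B).

Let ctr (x : 'I_2 -> R) (d : 'I_2 -> 'I_2 -> R) (y : 'I_2 -> R) : R :=
  \sum_A \sum_B x A * d A B * y B.
(* [nabla^A x_A] with [nabla^A = eps^{AB} nabla_B] *)
Let div_up (d : 'I_2 -> 'I_2 -> R) : R := \sum_A \sum_B eps A B * d B A.
(* [bar nabla_A x^A] with [bar nabla_A = bar nabla^B eps_{BA}] *)
Let div_dn (d : 'I_2 -> 'I_2 -> R) : R := \sum_A \sum_B d B A * eps B A.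

Definition psi0 : R := \sum_A Pi p A * iota p A.
Definition psi1 : R :=
  \sum_A Pi p A * oU p A - 2 / sq3 * ctr (iota p) n_i (iL p).
Definition psi2 : R :=
  ctr (iL p) b_o (oU p) + ctr (o p) b_o (iota p) - div_dn b_oU
  + 2 * ctr (o p) b_iL (oU p).
Definition psi3 : R :=
  ctr (iL p) b_iL (oU p) + ctr (o p) b_iL (iota p) - 3^-1 * div_dn b_i
  + 2 / 3 * ctr (iL p) b_o (iota p) + 2 / sq3 * ctr (oU p) n_oU (o p).
Definition psi4 : R :=
  ctr (oU p) n_oU (iL p) + ctr (iota p) n_oU (o p) - 3^-1 * div_up n_o
  + 2 / 3 * ctr (oU p) n_i (o p) + 2 / sq3 * ctr (iL p) b_iL (iota p).
Definition psi5 : R :=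
  ctr (oU p) n_i (iL p) + ctr (iota p) n_i (o p) - div_up n_iL
  + 2 * ctr (iota p) n_oU (iL p).
Definition psi6 : R :=
  \sum_A Sig p A * iL p A + 2 / sq3 * ctr (o p) b_o (oU p).
Definition psi7 : R := \sum_A Sig p A * o p A.

End Psi.
End Bundles.

(* Main.v *)
Require Import Defs.
From HB Require Import structures.
From mathcomp Require Import all_boot all_order all_algebra.
From mathcomp Require Import all_classical all_reals all_analysis.
From mathcomp Require Import ring.
Import Order.TTheory GRing.Theory Num.Theory.
Import numFieldNormedType.Exports.
Local Open Scope classical_set_scope.
Local Open Scope ring_scope.

Set Implicit Arguments.
Unset Strict Implicit.
Unset Printing Implicit Defensive.

(** Write [r] for the square root of 3 and identify [Lambda^1_H[2,2]] with binary
    cubics through the given isomorphism [J], so that [o_A], [-iota_A / r],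
    [-o^A / r], [iota^A] are the images of [1, X, X^2, X^3].  The projection of
    2-forms to [Sym^4] sends [J c /\ J d] to [c d' - c' d], and the projection of
    [Hom (Sym^3, Sym^4)] to [Sym^7] sends [q] to
    [q(X^3) - 3 X q(X^2) + 3 X^2 q(X) - X^3 q(1)].  The torsion is thus known once
    the partial torsion is evaluated on four sections of [Lambda^1_H] which at
    each point are multiples of the [J(X^m)].

    Such sections exist because every density bundle has a positive section: the
    orientations of [L] and [det E] are given by global sections, whose real
    powers have all the weights ([kappa]).  So let [kappa_m] be a positive density
    of weight [[m-2,1-m]], and [w_m = kappa_m J(X^m)].

    The Rumin operator is the antisymmetrised preferred connection plus the
    obstruction terms ([d_perp_obstruction]).  Any connection on [S] and the
    preferred connection differ on [w_m] by the derivative of [J(X^m)] along the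
    preferred connection and by terms
    [((1-m) alpha + (m-2) beta) X^m + (3-m) gamma X^(m+1) + m delta X^(m-1)] with
    arbitrary 1-forms [alpha, beta, gamma, delta] ([induced_cubic_section],
    [nabla_cubic_section]).  On a fixed 1-form [J(X^i)] the contribution of the
    latter to the torsion is a third difference in [m] of a polynomial of degree
    2, so it vanishes ([sym7_connection_change]).  This is the independence of the
    torsion from the connection, and also removes the derivatives of the densities
    [kappa_m], since the logarithmic derivative of [kappa_m] is affine in [m].

    What remains involves only derivatives of [o] and [iota] and the obstructions
    ([torsion_spinor_form]).  Expanding 2-forms in the basis [J(X^i) /\ J(X^j)]
    ([qapp_spinor]) shows that the eight coefficients of the torsion are nonzero
    multiples of [psi0, psi1, psi5, psi4, psi3, psi2, psi6, psi7]
    ([torsion_coefficients]). *)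

(** * Smooth functions *)

Lemma CkW (R : realType) k (U : set 'rV[R]_5) f : Ck k.+1 U f -> Ck k U f.
Proof.
elim: k f => [|k IH] f [fc fd]; split => // v; split; first exact: (fd v).1.
exact: IH (fd v).2.
Qed.

(** [Ck] mentions values of [f] outside [U], but only germs at points of the open
    set [U] matter. *)
Lemma eq_Ck (R : realType) k (U : set 'rV[R]_5) f g :
  open U -> (forall x, U x -> f x = g x) -> Ck k U f -> Ck k U g.
Proof.
move=> oU.
have fgn h h' : (forall x, U x -> h x = h' x) -> forall x, U x ->
    \forall y \near x, h y = h' y :> R.
  move=> hh' x Ux; have : \forall y \near x, U y by exact: open_nbhs_nbhs.
  by apply: filterS.
have eq_cont h h' : (forall x, U x -> h x = h' x) ->
    (forall x, U x -> {for x, continuous h}) ->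
    (forall x, U x -> {for x, continuous (h' : _ -> R)}).
  move=> hh' hc x Ux; have hx : h y @[y --> x] --> h x by exact: hc.
  change (h' y @[y --> x] --> h' x); rewrite -(hh' x Ux).
  exact: cvg_trans (near_eq_cvg (fgn _ _ hh' x Ux)) hx.
elim: k f g => [|k IH] f g fg [fc fd]; split => //; try exact: eq_cont fg fc.
move=> v; split=> [x Ux|].
  exact: near_eq_derivable (fgn _ _ fg x Ux) ((fd v).1 x Ux).
apply: IH (fd v).2 => x Ux; apply: near_eq_derive; exact: (fgn f g fg x Ux).
Qed.

Lemma CkD (R : realType) k (U : set 'rV[R]_5) f g :
  open U -> Ck k U f -> Ck k U g -> Ck k U (fun x => f x + g x).
Proof.
move=> oU; elim: k f g => [|k IH] f g [fc fd] [gc gd]; split=> //.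
1,2: by move=> x Ux; apply: (@continuousD _ _ _ f g); [exact: fc|exact: gc].
move=> v; split=> [x Ux|].
  by apply: derivableD; [exact: (fd v).1|exact: (gd v).1].
apply: eq_Ck (IH _ _ (fd v).2 (gd v).2) => // x Ux.
by rewrite -(deriveD ((fd v).1 x Ux) ((gd v).1 x Ux)).
Qed.

Lemma CkM (R : realType) k (U : set 'rV[R]_5) f g :
  open U -> Ck k U f -> Ck k U g -> Ck k U (fun x => f x * g x).
Proof.
move=> oU; elim: k f g => [|k IH] f g Hf Hg; split=> //.
1,2: by move=> x Ux; apply: (@continuousM _ _ f g);
  [exact: Hf.1|exact: Hg.1].
case: (Hf) (Hg) => fc fd [gc gd] v; split=> [x Ux|].
  by apply: derivableM; [exact: (fd v).1|exact: (gd v).1].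
apply: (@eq_Ck _ _ _ (fun x => f x * 'D_v g x + g x * 'D_v f x)) => //.
  by move=> x Ux; rewrite -(deriveM ((fd v).1 x Ux) ((gd v).1 x Ux)).
apply: CkD => //; apply: IH; try exact: CkW.
- exact: (gd v).2.
- exact: (fd v).2.
Qed.

Lemma Ck_cst (R : realType) k (U : set 'rV[R]_5) (c : R) : Ck k U (fun=> c).
Proof.
elim: k c => [|k IH] c; split=> //; try by move=> x _; exact: cst_continuous.
move=> v; split=> [x _|]; first exact: derivable_cst.
have -> : (fun x => 'D_v (fun=> c) x) = (fun=> 0 : R) :> ('rV[R]_5 -> R).
  by rewrite funeqE => x; exact: derive_cst.
exact: IH.
Qed.

(** The derivative along [v] is the one-variable derivative of [t |-> f (t v + x)]
    at 0, to which the chain rule applies. *)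
Lemma derive_powR (R : realType) (f : 'rV[R]_5 -> R) (r : R) x v :
  0 < f x -> derivable f x v ->
  derivable (fun y => f y `^ r) x v /\
  'D_v (fun y => f y `^ r) x = r * f x `^ (r - 1) * 'D_v f x.
Proof.
move=> fx df.
have f1 := (derivable1P _ _ _).1 df.
have E g : 'D_v g x = (fun h : R => g (h *: v + x) : R)^`()%classic 0.
  rewrite derive1E /derive; set g1 := fun h => h^-1 *: _.
  set g2 := fun h => h^-1 *: _.
  suff -> : g1 = g2 by [].
  by rewrite funeqE /g1 /g2 => h /=; rewrite addr0 scale0r add0r [_%:A]mulr1.
pose g h := f (h *: v + x).
have g0 : 0 < g 0 by rewrite /g scale0r add0r.
have [dp dpE] := is_derive1_powR r g0.
split.
  apply/derivable1P; apply/derivable1_diffP.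
  have : differentiable ((@powR R ^~ r) \o g) (0 : R).
    by apply: differentiable_comp; exact/derivable1_diffP.
  by [].
rewrite !E (_ : (fun h => f (h *: v + x) `^ r) = (@powR R ^~ r) \o g) //.
rewrite derive1_comp // [X in X * _]derive1E dpE.
by rewrite /g scale0r add0r.
Qed.

Lemma Ck_powR (R : realType) k (U : set 'rV[R]_5) f (r : R) :
  open U -> (forall x, U x -> 0 < f x) -> Ck k U f ->
  Ck k U (fun x => f x `^ r).
Proof.
move=> oU f0; elim: k r => [|k IH] r Hf; split=> //.
1,2: move=> x Ux; apply: (@continuous_comp _ _ _ f (@powR R ^~ r)); [exact: Hf.1|].
1,2: apply: differentiable_continuous; apply/derivable1_diffP;
  by apply: ex_derive; apply: is_derive1_powR; exact: f0.
case: (Hf) => fc fd v; split=> [x Ux|].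
  by have [] := derive_powR r (f0 _ Ux) ((fd v).1 _ Ux).
apply: (@eq_Ck _ _ _ (fun x => r * f x `^ (r - 1) * 'D_v f x)) => //.
  by move=> x Ux; have [_ ->] := derive_powR r (f0 _ Ux) ((fd v).1 _ Ux).
apply: CkM => //; last exact: (fd v).2.
apply: CkM => //; first exact: Ck_cst.
by apply: IH; exact: CkW.
Qed.

Section SmoothOn.
Context {R : realType} {M : manifold5 R}.
Implicit Types (U : set M) (f g : M -> R).

Lemma atlas_chart (c : chart R M) : atlas c -> is_chart c.
Proof. by case: M c => T a h1 h2 isch h3 h4 c; exact: isch. Qed.

Lemma open_chart_image U (c : chart R M) :
  open U -> atlas c -> open (cmap c @` (U `&` cdom c)).
Proof.
move=> oU /atlas_chart[odom oim iK cc ic].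
have -> : cmap c @` (U `&` cdom c) = cmap c @` cdom c `&` (cinv c @^-1` U).
  apply/seteqP; split=> y.
    by move=> [x [Ux dx] <-]; split; [exists x|rewrite /= iK].
  by move=> [[x dx <-]] /=; rewrite iK // => Ux; exists x.
rewrite openE => y yU; have {yU} [yim Uy] := yU.
apply: filterI; first exact: open_nbhs_nbhs.
by apply: ic => //; exact: open_nbhs_nbhs.
Qed.

Lemma eq_smooth_on U f g : open U -> (forall x, U x -> f x = g x) ->
  smooth_on U f -> smooth_on U g.
Proof.
move=> oU fg Hf c ac k; apply: eq_Ck (Hf c ac k); first exact: open_chart_image.
move=> _ [x [Ux dx] <-] /=; have [_ _ iK _ _] := atlas_chart ac.
by rewrite iK // fg.
Qed.

Lemma smooth_on_cst U (r : R) : smooth_on U (fun=> r).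
Proof. by move=> c ac k; exact: Ck_cst. Qed.

Lemma smooth_onM U f g : open U -> smooth_on U f -> smooth_on U g ->
  smooth_on U (fun x => f x * g x).
Proof.
move=> oU Hf Hg c ac k; apply: (@CkM _ _ _ (f \o cinv c) (g \o cinv c)).
- exact: open_chart_image.
- exact: Hf.
- exact: Hg.
Qed.

Lemma smooth_onN U f : open U -> smooth_on U f -> smooth_on U (fun x => - f x).
Proof.
move=> oU sf; apply: (@eq_smooth_on _ (fun x => -1 * f x)) => //.
  by move=> x _; rewrite mulN1r.
by apply: smooth_onM => //; exact: smooth_on_cst.
Qed.

Lemma smooth_on_powR U f (r : R) : open U -> (forall x, U x -> 0 < f x) ->
  smooth_on U f -> smooth_on U (fun x => f x `^ r).
Proof.
move=> oU f0 Hf c ac k; apply: (@Ck_powR _ _ _ (f \o cinv c)).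
- exact: open_chart_image.
- move=> _ [x [Ux dx] <-] /=; have [_ _ iK _ _] := atlas_chart ac.
  by rewrite iK // f0.
- exact: Hf.
Qed.

End SmoothOn.

(** * Antisymmetry of the exterior derivative *)

Section Derivations.
Context {R : realType} {M : manifold5 R}.

Lemma tangent0 (x : M) : is_tangent x (fun=> 0).
Proof. by split=> *; rewrite ?(addr0, mulr0). Qed.

(** A derivation kills constants: [w 1 = w (1 * 1) = 2 w 1]. *)
Lemma tangent_cst (x : M) w (k : R) : is_tangent x w -> w (fun=> k) = 0.
Proof.
move=> [_ wZ wM _]; have sk (c : R) : smooth (fun _ : M => c) by exact: smooth_on_cst.
have w1 : w (fun=> 1) = 0.
  have := wM _ _ (sk 1) (sk 1).
  by rewrite !mul1r -[LHS]addr0 => /addrI.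
rewrite -[RHS](mulr0 k) -w1 -wZ //; congr w.
by apply/funext => y; rewrite mulr1.
Qed.

(** In the Leibniz rule for [X Y] the mixed terms [X f * Y g + Y f * X g] are
    symmetric in [X] and [Y], so that they cancel in the bracket. *)
Lemma bracket_tangent (X Y : M -> tvec M) x :
  smooth_vf setT X -> smooth_vf setT Y -> is_tangent x (bracket X Y x).
Proof.
move=> [tX sX] [tY sY].
have aux (Z W : M -> tvec M) : (forall x, setT x -> is_tangent x (Z x)) ->
    (forall x, setT x -> is_tangent x (W x)) ->
    (forall f, smooth f -> smooth (fun y => W y f)) ->
    [/\ forall f g, smooth f -> smooth g ->
        Z x (fun y => W y (fun z => f z + g z)) =
        Z x (fun y => W y f) + Z x (fun y => W y g),
      forall (k : R) f, smooth f ->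
        Z x (fun y => W y (fun z => k * f z)) = k * Z x (fun y => W y f),
      forall f g, smooth f -> smooth g ->
        Z x (fun y => W y (fun z => f z * g z)) =
        (f x * Z x (fun y => W y g) + W x g * Z x f) +
        (g x * Z x (fun y => W y f) + W x f * Z x g)
      & forall f, ~ smooth f -> Z x (fun y => W y f) = 0].
  move=> tZ tW sW; have [ZD ZZ ZM Z0] := tZ x I; split=> [f g sf sg|k f sf|f g sf sg|f sf].
  - rewrite -ZD; [|exact: sW..]; congr (Z x _); apply/funext => y.
    by have [WD _ _ _] := tW y I; exact: WD.
  - rewrite -ZZ; last exact: sW; congr (Z x _); apply/funext => y.
    by have [_ WZ _ _] := tW y I; exact: WZ.
  - have sM h k : smooth h -> smooth k -> smooth (fun y : M => h y * k y).
      by move=> sh sk; apply: smooth_onM => //; exact: openT.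
    rewrite -!ZM; try exact: sW; try exact: sf; try exact: sg.
    rewrite -ZD; [|by apply: sM => //; exact: sW..].
    congr (Z x _); apply/funext => y.
    by have [_ _ WM _] := tW y I; exact: WM.
  - rewrite -[RHS](tangent_cst 0 (tZ x I)); congr (Z x _); apply/funext => y.
    by have [_ _ _ W0] := tW y I; exact: W0.
have [XD XZ XM X0] := aux X Y tX tY sY.
have [YD YZ YM Y0] := aux Y X tY tX sX.
split=> [f g sf sg|k f sf|f g sf sg|f sf]; rewrite /bracket.
- by rewrite XD // YD //; ring.
- by rewrite XZ // YZ //; ring.
- by rewrite XM // YM //; ring.
- by rewrite X0 // Y0 // subr0.
Qed.

Lemma extend_cases x (u : tvec M) :
  smooth_vf setT (extend x u) \/ extend x u = fun _ _ => 0.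
Proof.
rewrite /extend; case: pselect => [h|_]; last by right.
by left; case: (cid h) => X [].
Qed.

Lemma extend_bracket_tangent x (u v : tvec M) :
  is_tangent x (bracket (extend x u) (extend x v) x).
Proof.
have E0 X : smooth_vf setT X \/ X = (fun _ _ => 0) ->
    X x (fun=> 0) = 0 :> R.
  by case=> [[tX _]|->] //; exact: tangent_cst 0 (tX x I).
have br0 (X Y : M -> tvec M) : X x (fun=> 0) = 0 -> Y x (fun=> 0) = 0 ->
    X = (fun _ _ => 0) \/ Y = (fun _ _ => 0) ->
    bracket X Y x = fun=> 0.
  by move=> X0 Y0 [E|E]; apply/funext => f; rewrite /bracket E /= ?X0 ?Y0 subr0.
have [sX|X0] := extend_cases x u; last first.
  by rewrite br0; [exact: tangent0| apply: E0; exact: extend_cases..|left].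
have [sY|Y0] := extend_cases x v; last first.
  by rewrite br0; [exact: tangent0| apply: E0; exact: extend_cases..|right].
exact: bracket_tangent.
Qed.

(** The first two terms of [dw(X,Y)] are exchanged; the third changes sign because
    [w] is linear on tangent vectors, of which the bracket is one. *)
Lemma dform_anti (w : form1 M) x u v : smooth_form1 w ->
  dform w x v u = - dform w x u v.
Proof.
move=> [wlin _]; rewrite /dform.
have tb := extend_bracket_tangent x u v.
have w0 : w x (fun=> 0) = 0.
  have := wlin x 1 _ _ (tangent0 x) (tangent0 x).
  rewrite (_ : (fun f => _) = fun=> 0); last by apply/funext => f; rewrite mulr0 addr0.
  by rewrite mul1r => /(congr1 (fun z => z - w x (fun=> 0))); rewrite subrr addrK.
have -> : bracket (extend x v) (extend x u) x =
    fun f => -1 * bracket (extend x u) (extend x v) x f + (fun=> 0) f.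
  by apply/funext => f; rewrite /bracket; ring.
by rewrite (wlin _ _ _ _ tb (tangent0 x)) w0; ring.
Qed.

End Derivations.

(** * Positive densities of every weight *)

Lemma sumI2 (V : nmodType) (F : 'I_2 -> V) : \sum_i F i = F 0 + F 1.
Proof. by rewrite !big_ord_recl big_ord0 addr0; congr (F _ + F _); apply/val_inj. Qed.

Lemma I2P (P : 'I_2 -> Prop) : P 0 -> P 1 -> forall i, P i.
Proof.
move=> P0 P1 [[|[|//]] h]; [have -> : Ordinal h = 0|have -> : Ordinal h = 1] => //;
  exact/val_inj.
Qed.

Lemma det2 (R : comPzRingType) (g : 'M[R]_2) :
  \det g = g 0 0 * g 1 1 - g 0 1 * g 1 0.
Proof.
rewrite (expand_det_row _ 0) sumI2 /cofactor !det_mx11 !mxE /=.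
have -> : lift 0 0 = 1 :> 'I_2 by apply/val_inj.
have -> : lift 1 0 = 0 :> 'I_2 by apply/val_inj.
by rewrite /= expr0 expr1; ring.
Qed.

Section Densities.
Context {R : realType} {M : manifold5 R} (G : legendrean M).
Implicit Types (p : frame G) (u v : R) (V W : @bundle R).

Lemma fl_gt0 p : 0 < fl p. Proof. by case: p. Qed.

Definition frame_vol p : R := vol G (base p) (fe p 0) (fe p 1).

Lemma frame_vol_gt0 p : 0 < frame_vol p. Proof. by rewrite /frame_vol; case: p. Qed.

Lemma fe_bE p A : bE G (base p) (fe p A).
Proof.
case: p => b e f l [eE _] _ _ _ _ /=; apply/eE.
exists (fun i => (i == A)%:R); apply/funext => h; rewrite /tcomb.
by rewrite (bigD1 A) //= eqxx mul1r big1 ?addr0 // => i /negbTE ->; rewrite mul0r.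
Qed.

Lemma ff_bF p A : bF G (base p) (ff p A).
Proof.
case: p => b e f l _ [fF _] _ _ _ /=; apply/fF.
exists (fun i => (i == A)%:R); apply/funext => h; rewrite /tcomb.
by rewrite (bigD1 A) //= eqxx mul1r big1 ?addr0 // => i /negbTE ->; rewrite mul0r.
Qed.

(** Linearity of [vol] in the second argument follows from linearity in the first
    and skewness. *)
Lemma vol_tcomb x (e : 'I_2 -> tvec M) (g : 'M[R]_2) :
  (forall A, bE G x (e A)) -> is_basis2 (bE G x) e ->
  vol G x (tcomb (g 0) e) (tcomb (g 1) e) = \det g * vol G x (e 0) (e 1).
Proof.
move=> eE [eb _].
have [va vl] : (forall y z, bE G x y -> bE G x z -> vol G x y z = - vol G x z y) /\
   (forall (k : R) y y' z, bE G x y -> bE G x y' -> bE G x z ->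
     vol G x (fun f => k * y f + y' f) z = k * vol G x y z + vol G x y' z).
  by case: (G) => /= *; split; auto.
have ce k : bE G x (tcomb k e) by apply/eb; exists k.
have E0 : bE G x (fun=> 0).
  rewrite (_ : (fun=> 0) = tcomb (fun=> 0) e) //.
  by apply/funext => f; rewrite /tcomb big1 // => i _; rewrite mul0r.
have v0 z : bE G x z -> vol G x (fun=> 0) z = 0.
  move=> Ez; have E := vl (-1) _ _ _ E0 E0 Ez; rewrite mulN1r addNr in E.
  by rewrite E mulN1r addNr.
have vZ k y z : bE G x y -> bE G x z ->
    vol G x (fun f => k * y f + 0) z = k * vol G x y z.
  by move=> Ey Ez; rewrite (vl _ _ _ _ Ey E0 Ez) v0 // addr0.
have vv z : bE G x z -> vol G x z z = 0.
  move=> Ez; have /eqP := va z z Ez Ez.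
  by rewrite -addr_eq0 -mulr2n mulrn_eq0 => /eqP.
have Z1 k A : bE G x (fun f => k * e A f + 0).
  rewrite (_ : (fun f => k * e A f + 0) = tcomb (fun i => k * (i == A)%:R) e) //.
  apply/funext => f; rewrite addr0 /tcomb (bigD1 A) //= eqxx mulr1 big1 ?addr0 //.
  by move=> i /negbTE ->; rewrite mulr0 mul0r.
have vc k z : bE G x z ->
    vol G x (tcomb k e) z = k 0 * vol G x (e 0) z + k 1 * vol G x (e 1) z.
  move=> Ez; rewrite -(vZ (k 1)) // -vl //.
  by congr (vol G x _ z); apply/funext => f; rewrite /tcomb sumI2 addr0.
rewrite vc // (va (e 0)) // (va (e 1)) // !vc // !vv // (va (e 1) (e 0)) //.
by rewrite det2; ring.
Qed.

Lemma frame_basis p : is_basis2 (bE G (base p)) (fe p).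
Proof. by case: p. Qed.

Lemma frame_vol_change p p' (g : 'M[R]_2) : base p' = base p ->
  (forall A, fe p' A = tcomb (g A) (fe p)) -> frame_vol p' = \det g * frame_vol p.
Proof.
move=> bp gp; rewrite /frame_vol bp !gp vol_tcomb //; last exact: frame_basis.
exact: fe_bE.
Qed.

Lemma det_frame_gt0 p p' (g : 'M[R]_2) : base p' = base p ->
  (forall A, fe p' A = tcomb (g A) (fe p)) -> 0 < \det g.
Proof.
move=> bp gp; rewrite -(pmulr_lgt0 _ (frame_vol_gt0 p)) -(frame_vol_change bp gp).
exact: frame_vol_gt0.
Qed.

(** With [vol] of weight [[-3,1]] and the coefficient [fl] of [lam] of weight
    [[1,1]], both positive on adapted frames, this is a positive section of
    [[u,v]]. *)
Definition kappa (u v : R) : tfield G (Bdens u v) :=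
  fun p _ => frame_vol p `^ ((v - u) / 4) * fl p `^ ((u + 3 * v) / 4).

Arguments kappa : clear implicits.

Lemma kappa_gt0 u v p : 0 < kappa u v p tt.
Proof. by rewrite mulr_gt0 // powR_gt0 // ?frame_vol_gt0 ?fl_gt0. Qed.

Lemma kappaD u v u' v' p :
  kappa (u + u') (v + v') p tt = kappa u v p tt * kappa u' v' p tt.
Proof.
have powD x r t : 0 < x -> x `^ (r + t) = x `^ r * x `^ t :> R.
  by move=> x0; rewrite powRD // lt0r_neq0 // implybT.
rewrite /kappa mulrACA -!powD ?frame_vol_gt0 ?fl_gt0 //.
by congr (_ `^ _ * _ `^ _); ring.
Qed.

Lemma frame_vol_smooth (U : set M) (s : M -> frame G) : open U -> smooth_frame U s ->
  smooth_on U (fun x => frame_vol (s x)).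
Proof.
move=> oU [bs hs _].
have volS : forall X Y, smooth_vf U X -> smooth_vf U Y ->
    (forall x, U x -> bE G x (X x) /\ bE G x (Y x)) ->
    smooth_on U (fun x => vol G x (X x) (Y x)).
  by case: (G) oU => /= *; auto.
apply: (@eq_smooth_on _ _ _ (fun x => vol G x (fe (s x) 0) (fe (s x) 1))) => //.
  by move=> x Ux; rewrite /frame_vol bs.
apply: volS; [exact: (hs (inl 0))|exact: (hs (inl 1))|].
by move=> x Ux; rewrite -{1 3}(bs x Ux); split; exact: fe_bE.
Qed.

Lemma kappa_smooth u v (U : set M) (s : M -> frame G) : open U ->
  smooth_frame U s -> smooth_on U (fun x => kappa u v (s x) tt).
Proof.
move=> oU sU; apply: smooth_onM => //; apply: smooth_on_powR => //.
- by move=> x _; exact: frame_vol_gt0.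
- exact: frame_vol_smooth.
- by move=> x _; exact: fl_gt0.
- by case: sU.
Qed.

Lemma kappa_frame u v p p' (g : 'M[R]_2) : base p' = base p ->
  (forall A, fe p' A = tcomb (g A) (fe p)) ->
  kappa u v p' tt = dweight u v g (fl p' / fl p) * kappa u v p tt.
Proof.
move=> bp gp; have d0 := det_frame_gt0 bp gp.
rewrite /kappa /dweight mulrACA -!powRM ?divr_ge0 ?ltW ?frame_vol_gt0 ?fl_gt0 //.
by rewrite -(frame_vol_change bp gp) divfK // gt_eqF // fl_gt0.
Qed.

Lemma kappa_section u v : is_section (kappa u v).
Proof.
split=> [p p' g bp gp []|U s oU sU []]; last exact: kappa_smooth.
by rewrite (big_pred1 tt) => [|[]//]; exact: kappa_frame.
Qed.

(** [dweight u v] is the factor by which the nonzero number [kappa u v] changes,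
    so its multiplicativity comes from that of [kappa]; the frames are there to
    make [\det g] and the quotient of the [fl] positive. *)
Lemma dweightD u v u' v' p p' (g : 'M[R]_2) : base p' = base p ->
  (forall A, fe p' A = tcomb (g A) (fe p)) ->
  dweight (u + u') (v + v') g (fl p' / fl p) =
  dweight u v g (fl p' / fl p) * dweight u' v' g (fl p' / fl p).
Proof.
move=> bp gp; have kn a b : kappa a b p tt != 0 by rewrite gt_eqF // kappa_gt0.
apply: (mulIf (kn (u + u') (v + v'))); rewrite -(kappa_frame _ _ bp gp).
by rewrite !kappaD !(kappa_frame _ _ bp gp) mulrACA.
Qed.

Lemma sectionM V u v u' v' (f : tfield G (Bdens u v)) (s : tfield G (wt V u' v')) :
  is_section f -> is_section s ->
  @is_section _ _ G (wt V (u + u') (v + v')) (fun p i => f p tt * s p i).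
Proof.
move=> [ft fs] [st ss]; split=> [p p' g bp gp i|U fr oU sU i]; last first.
  by apply: smooth_onM => //; [exact: fs|exact: ss].
rewrite (ft _ _ _ bp gp) (st _ _ _ bp gp) (big_pred1 tt) => [|[]//] /=.
rewrite mulr_sumr; apply: eq_bigr => j _.
by rewrite (dweightD _ _ _ _ bp gp); ring.
Qed.

End Densities.

Arguments kappa {R M} G u v.

(** * Spinor indices and sections of associated bundles *)

Lemma kronE (R : realType) : (kron 0 0 = 1 :> R) * (kron 0 1 = 0 :> R) *
  (kron 1 0 = 0 :> R) * (kron 1 1 = 1 :> R).
Proof. by do !split. Qed.

Lemma epsE (R : realType) : (eps 0 0 = 0 :> R) * (eps 0 1 = 1 :> R) *
  (eps 1 0 = -1 :> R) * (eps 1 1 = 0 :> R).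
Proof. by do !split; rewrite /eps !kronE; ring. Qed.

Lemma invmx2 (R : fieldType) (g : 'M[R]_2) : \det g != 0 ->
  [/\ \det g * invmx g 0 0 = g 1 1, \det g * invmx g 0 1 = - g 0 1,
      \det g * invmx g 1 0 = - g 1 0 & \det g * invmx g 1 1 = g 0 0].
Proof.
move=> d0; have ug : g \in unitmx by rewrite unitmxE unitfE.
have e i j : g i 0 * invmx g 0 j + g i 1 * invmx g 1 j = (i == j)%:R.
  by have /matrixP/(_ i j) := mulmxV ug; rewrite !mxE sumI2.
have [e00 e01 e10 e11] : [/\ g 0 0 * invmx g 0 0 + g 0 1 * invmx g 1 0 = 1,
    g 0 0 * invmx g 0 1 + g 0 1 * invmx g 1 1 = 0,
    g 1 0 * invmx g 0 0 + g 1 1 * invmx g 1 0 = 0 &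
    g 1 0 * invmx g 0 1 + g 1 1 * invmx g 1 1 = 1] by split; exact: e.
rewrite det2; split.
- transitivity (g 1 1 * (g 0 0 * invmx g 0 0 + g 0 1 * invmx g 1 0)
    - g 0 1 * (g 1 0 * invmx g 0 0 + g 1 1 * invmx g 1 0)); first by ring.
  by rewrite e00 e10; ring.
- transitivity (g 1 1 * (g 0 0 * invmx g 0 1 + g 0 1 * invmx g 1 1)
    - g 0 1 * (g 1 0 * invmx g 0 1 + g 1 1 * invmx g 1 1)); first by ring.
  by rewrite e01 e11; ring.
- transitivity (g 0 0 * (g 1 0 * invmx g 0 0 + g 1 1 * invmx g 1 0)
    - g 1 0 * (g 0 0 * invmx g 0 0 + g 0 1 * invmx g 1 0)); first by ring.
  by rewrite e00 e10; ring.
- transitivity (g 0 0 * (g 1 0 * invmx g 0 1 + g 1 1 * invmx g 1 1)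
    - g 1 0 * (g 0 0 * invmx g 0 1 + g 0 1 * invmx g 1 1)); first by ring.
  by rewrite e01 e11; ring.
Qed.

Section Sections.
Context {R : realType} {M : manifold5 R} (G : legendrean M).
Implicit Types (p : frame G) (u v : R).

Lemma lowerE (t : frame G -> 'I_2 -> R) p :
  (lower t p 0 = - t p 1) * (lower t p 1 = t p 0).
Proof. by rewrite /lower !sumI2 !epsE !(mulr0, mulr1, mulrN1, addr0, add0r). Qed.

Lemma raiseE (s : frame G -> 'I_2 -> R) p :
  (raise s p 0 = s p 1) * (raise s p 1 = - s p 0).
Proof. by rewrite /raise !sumI2 !epsE !(mul0r, mul1r, mulN1r, addr0, add0r). Qed.

(** This is the invariance of [epsilon] as a section of [Lambda^2 E^*[3,-1]]. *)
Lemma dweight_eps p p' (g : 'M[R]_2) : base p' = base p ->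
  (forall A, fe p' A = tcomb (g A) (fe p)) ->
  dweight (-3) 1 g (fl p' / fl p) = \det g.
Proof.
move=> bp gp; have d0 := det_frame_gt0 bp gp; rewrite /dweight mulr1 addNr mul0r powRr0 mulr1.
by rewrite (_ : (1 - (-3)) / 4 = 1) ?powRr1 ?ltW //; field.
Qed.

(** The inverse of a 2 by 2 matrix is conjugate by [epsilon] to its transpose, up
    to the determinant, which accounts for the change of weight. *)
Lemma section_raise u v (s : tfield G (wt BEd u v)) : is_section s ->
  @is_section _ _ G (wt BE (u - 3) (v + 1)) (raise s).
Proof.
move=> [st ss]; split=> [p p' g bp gp|U fr oU sU].
  have d0 := det_frame_gt0 bp gp; have [i00 i01 i10 i11] := invmx2 (lt0r_neq0 d0).
  have E := st _ _ _ bp gp.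
  have [g00 g01 g10 g11] : [/\ g 0 0 = \det g * invmx g 1 1,
    g 0 1 = - (\det g * invmx g 0 1), g 1 0 = - (\det g * invmx g 1 0) &
    g 1 1 = \det g * invmx g 0 0] by rewrite i00 i01 i10 i11 !opprK.
  apply: I2P; rewrite sumI2 !raiseE !E !sumI2 /= (dweightD _ _ _ _ bp gp)
    (dweight_eps bp gp).
    by rewrite g10 g11; ring.
  by rewrite g00 g01; ring.
apply: I2P.
  apply: (@eq_smooth_on _ _ _ (fun x => s (fr x) 1)) => //; last exact: ss.
  by move=> x _; rewrite raiseE.
apply: (@eq_smooth_on _ _ _ (fun x => - s (fr x) 0)) => //.
  by move=> x _; rewrite raiseE.
by apply: smooth_onN => //; exact: ss.
Qed.

Lemma section_lower u v (t : tfield G (wt BE u v)) : is_section t ->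
  @is_section _ _ G (wt BEd (u + 3) (v - 1)) (lower t).
Proof.
move=> [st ss]; split=> [p p' g bp gp|U fr oU sU].
  have d0 := det_frame_gt0 bp gp; have [i00 i01 i10 i11] := invmx2 (lt0r_neq0 d0).
  have E := st _ _ _ bp gp.
  have [g00 g01 g10 g11] : [/\ g 0 0 = \det g * invmx g 1 1,
    g 0 1 = - (\det g * invmx g 0 1), g 1 0 = - (\det g * invmx g 1 0) &
    g 1 1 = \det g * invmx g 0 0] by rewrite i00 i01 i10 i11 !opprK.
  have Ew : dweight u v g (fl p' / fl p) =
      dweight (u + 3) (v - 1) g (fl p' / fl p) * \det g.
    by rewrite -(dweight_eps bp gp) -(dweightD _ _ _ _ bp gp) !addrK // subrK.
  apply: I2P; rewrite sumI2 !lowerE !E !sumI2 /= Ew.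
    by rewrite g00 g01; ring.
  by rewrite g10 g11; ring.
apply: I2P.
  apply: (@eq_smooth_on _ _ _ (fun x => - t (fr x) 1)) => //.
    by move=> x _; rewrite lowerE.
  by apply: smooth_onN => //; exact: ss.
apply: (@eq_smooth_on _ _ _ (fun x => t (fr x) 0)) => //; last exact: ss.
by move=> x _; rewrite lowerE.
Qed.

Definition embed_Ed (s : frame G -> 'I_2 -> R) : tfield G BL1H :=
  fun p a => if a is inl A then s p A else 0.

Definition embed_Fd (t : frame G -> 'I_2 -> R) : tfield G BL1H :=
  fun p a => if a is inr A then t p A else 0.

Lemma section_embed_Ed (s : tfield G (wt BEd 0 0)) :
  is_section s -> is_section (embed_Ed s).
Proof.
move=> [st ss]; split=> [p p' g bp gp [A|A]|U fr oU sU [A|A]].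
- rewrite big_sumType /= [X in _ + X]big1 ?addr0; last by move=> i _; rewrite mulr0.
  exact: (st _ _ _ bp gp).
- by rewrite big_sumType /= !big1 ?addr0 // => i _; rewrite ?mulr0 ?mul0r.
- exact: ss.
- exact: smooth_on_cst.
Qed.

Lemma section_embed_Fd (t : tfield G (wt BE (-1) (-1))) :
  is_section t -> is_section (embed_Fd t).
Proof.
move=> [st ss]; split=> [p p' g bp gp [A|A]|U fr oU sU [A|A]].
- by rewrite big_sumType /= !big1 ?addr0 // => i _; rewrite ?mulr0 ?mul0r.
- rewrite big_sumType /= [X in X + _]big1 ?add0r; last by move=> i _; rewrite mulr0.
  exact: (st _ _ _ bp gp).
- exact: smooth_on_cst.
- exact: ss.
Qed.

(** The positive section of the [j]-th summand of [S = [0,1] + [1,0]]. *)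
Definition basisS (j : 'I_2) : tfield G BS :=
  fun p i => (i == j)%:R * kappa G i%:R (1 - i%:R) p tt.

Lemma section_basisS j : is_section (basisS j).
Proof.
split=> [p p' g bp gp i|U fr oU sU i].
  rewrite (bigD1 i) //= big1 => [|k /negbTE ki]; last by rewrite eq_sym ki !mul0r.
  by rewrite eqxx mul1r addr0 /basisS (kappa_frame _ _ bp gp); ring.
apply: smooth_onM => //; first exact: smooth_on_cst.
exact: kappa_smooth.
Qed.

Lemma hv_tangent p a : is_tangent (base p) (hv p a).
Proof.
have b0 (V : set (tvec M)) e : is_basis2 V e -> V (fun=> 0).
  move=> [eV _]; apply/eV; exists (fun=> 0); apply/funext => f.
  by rewrite /tcomb big1 // => i _; rewrite mul0r.
have ker : forall x w, (is_tangent x w /\ lam G x w = 0) <->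
    exists y z, [/\ bE G x y, bF G x z & w = (fun f => y f + z f)].
  by case: (G).
have [bEp bFp] : is_basis2 (bE G (base p)) (fe p) /\ is_basis2 (bF G (base p)) (ff p).
  by case: p.
suff [] : is_tangent (base p) (hv p a) /\ lam G (base p) (hv p a) = 0 by [].
apply/ker; case: a => A /=.
  exists (fe p A), (fun=> 0); split; [exact: fe_bE|exact: b0 bFp|].
  by apply/funext => f; rewrite addr0.
exists (fun=> 0), (ff p A); split; [exact: b0 bEp|exact: ff_bF|].
by apply/funext => f; rewrite add0r.
Qed.

Lemma partial_connectionZ (V : bundle) (D : tfield G V -> tfield G (Btens BL1H V))
    (k : R) s : partial_connection D -> is_section s -> forall p a i,
  D (fun q j => k * s q j) p (a, i) = k * D s p (a, i).
Proof.
move=> [_ _ DL] hs p a i; rewrite (DL (fun=> k)) //; last exact: smooth_on_cst.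
by rewrite (tangent_cst _ (hv_tangent p a)) mul0r addr0.
Qed.

Lemma levi_anti a b : levi b a = - levi a b :> R.
Proof. by case: a b => A [] B; rewrite /= ?oppr0 ?opprK // /kron eq_sym. Qed.

(** If [w] has no lift, [lift w] is the zero form, for which this is trivial. *)
Lemma d_perp_anti (w : tfield G BL1H) p a b : d_perp w p b a = - d_perp w p a b.
Proof.
have -> : d_perp w p b a = dform (Defs.lift w) (base p) (hv p b) (hv p a) -
    (\sum_A dform (Defs.lift w) (base p) (hv p (inl A)) (hv p (inr A))) / 2 * levi b a by [].
rewrite levi_anti mulrN /d_perp /perp opprD; congr (_ - _).
rewrite /Defs.lift; case: pselect => [h|_]; last by rewrite /dform /=; ring.
by case: (cid h) => w' /= [sw' _]; exact: dform_anti.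
Qed.
End Sections.

(** * Two-forms as binary quartics *)

Section Forms.
Context {R : realType} {M : manifold5 R} {G : legendrean M}.
Implicit Types (p : frame G) (J : g2map G) (W : @form2 R).

Definition alt (N : Hidx -> Hidx -> R) : form2 := fun a b => N a b - N b a.

Lemma japp_Xn J p (i : 'I_4) a : japp J p 'X^i a = J p i a.
Proof.
rewrite /japp (bigD1 i) //= coefXn eqxx mul1r big1 ?addr0 // => k /negbTE ki.
by rewrite coefXn -[(k == i :> nat)]/(k == i) ki mul0r.
Qed.

Lemma jappD J p c d a : japp J p (c + d) a = japp J p c a + japp J p d a.
Proof. by rewrite /japp -big_split; apply: eq_bigr => i _; rewrite coefD mulrDl. Qed.

Lemma jappZ J p k c a : japp J p (k *: c) a = k * japp J p c a.
Proof. by rewrite /japp mulr_sumr; apply: eq_bigr => i _; rewrite coefZ mulrA. Qed.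

Section Qapp.
Variables (Q : frame G -> Hidx -> Hidx -> {poly R}) (p : frame G).

Lemma qappD W W' : qapp Q p (fun a b => W a b + W' a b) = qapp Q p W + qapp Q p W'.
Proof.
rewrite /qapp -big_split; apply: eq_bigr => a _; rewrite -big_split.
by apply: eq_bigr => b _; rewrite scalerDl.
Qed.

Lemma qappZ k W : qapp Q p (fun a b => k * W a b) = k *: qapp Q p W.
Proof.
rewrite /qapp scaler_sumr; apply: eq_bigr => a _; rewrite scaler_sumr.
by apply: eq_bigr => b _; rewrite scalerA.
Qed.

(** [perp W] and [W] differ by a multiple of the Levi form. *)
Lemma qapp_perp W : qapp Q p levi = 0 -> qapp Q p (perp W) = qapp Q p W.
Proof.
move=> q0; pose k := (\sum_A W (inl A) (inr A)) / 2.
have -> : perp W = fun a b => W a b + - k * levi a b.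
  by apply/funext => a; apply/funext => b; rewrite /perp mulNr.
by rewrite qappD qappZ q0 scaler0 addr0.
Qed.

End Qapp.

Section Spinors.
Variables (o iota : frame G -> 'I_2 -> R) (p : frame G).
Hypothesis hoi : \sum_A o p A * iota p A = 1.
Let J := spinor_g2map o iota.
Local Notation r := (Num.sqrt (3 : R)).

(** The 1-forms [J 1, J X, J X^2, J X^3] are [o_A], [- iota_A / r], [- o^A / r]
    and [iota^A]. *)
Lemma spinor_g2mapE A :
  [/\ japp J p 1 (inl A) = o p A, japp J p 'X (inl A) = - (lower iota p A / r),
      japp J p 'X^2 (inl A) = 0 & japp J p 'X^3 (inl A) = 0] /\
  [/\ japp J p 1 (inr A) = 0, japp J p 'X (inr A) = 0,
      japp J p 'X^2 (inr A) = - (raise o p A / r) & japp J p 'X^3 (inr A) = iota p A].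
Proof.
have E (k : 'I_4) b := japp_Xn J p k b.
have := (E 0, E 1, E (inord 2), E (inord 3)); rewrite /= !inordK // expr0 expr1.
by move=> [[[E0 E1] E2] E3]; rewrite !E0 !E1 !E2 !E3 /J /spinor_g2map /= !inordK.
Qed.

Definition contract (x : 'I_2 -> R) (d : 'I_2 -> 'I_2 -> R) (y : 'I_2 -> R) : R :=
  \sum_A \sum_B x A * d A B * y B.

(** The coefficients of [W] in the basis [J X^i /\ J X^j] are contractions of [W]
    with the dual basis [iota^A, r o^A, r iota_A, o_A] of [H]; on this basis [Q]
    is prescribed.  The coefficients of [J 1 /\ J X^3] and [J X /\ J X^2] both
    contribute to [X^2].  The factors [3] and [r ^+ 2] there are equal but of
    different origin: the first is the derivative of [X^3]. *)
Lemma qapp_spinor Q W : sym4_projection J Q -> (forall a b, W b a = - W a b) ->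
  let m A B := W (inl A) (inr B) in
  qapp Q p W =
    - r *: (W (inl 0) (inl 1))%:P
    + (2 * r * contract (iota p) m (lower iota p)) *: 'X
    + (3 * contract (iota p) m (o p) + r ^+ 2 * contract (raise o p) m (lower iota p)) *: 'X^2
    + (2 * r * contract (raise o p) m (o p)) *: 'X^3
    - (r * W (inr 0) (inr 1)) *: 'X^4.
Proof.
move=> hQ hW m; pose j := japp J p.
have r0 : r != 0 by rewrite sqrtr_eq0 -ltNge ltr0n.
have WE : W = fun a b =>
  (- r * W (inl 0) (inl 1)) * wedge (j 1) (j 'X) a b +
  ((r * contract (iota p) m (lower iota p)) * wedge (j 1) (j 'X^2) a b +
  (contract (iota p) m (o p) * wedge (j 1) (j 'X^3) a b +
  ((r ^+ 2 * contract (raise o p) m (lower iota p)) * wedge (j 'X) (j 'X^2) a b +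
  ((r * contract (raise o p) m (o p)) * wedge (j 'X) (j 'X^3) a b +
  (- r * W (inr 0) (inr 1)) * wedge (j 'X^2) (j 'X^3) a b)))).
  have E A := spinor_g2mapE A.
  have [[L0 L1 L2 L3] [N0 N1 N2 N3]] := (E 0); have [[K0 K1 K2 K3] [P0 P1 P2 P3]] := (E 1).
  have W0 a : W a a = 0.
    by have /eqP := hW a a; rewrite -addr_eq0 -mulr2n mulrn_eq0 => /eqP.
  have := hoi; rewrite sumI2 => oi.
  apply/funext => a; apply/funext => b; rewrite /wedge /j.
  case: a b => A [] B; move: A B; apply: I2P; apply: I2P;
    rewrite ?L0 ?L1 ?L2 ?L3 ?N0 ?N1 ?N2 ?N3 ?K0 ?K1 ?K2 ?K3 ?P0 ?P1 ?P2 ?P3;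
    rewrite /contract !sumI2 !lowerE !raiseE /m ?W0
      ?(hW (inl 0) (inl 1)) ?(hW (inr 0) (inr 1)) ?[W (inr _) (inl _)]hW;
    (* on EE and FF components the identity holds up to a factor [o.iota = 1], on
       mixed ones up to its square *)
    first [by field | by rewrite -[LHS]mulr1 -[X in _ * X = _]oi; field
          | by rewrite -[LHS]mulr1 -[X in _ * X = _](expr1n _ 2)
                -[X in _ * X ^+ 2 = _]oi; field].
have d (c e : {poly R}) : (size c <= 4)%N -> (size e <= 4)%N ->
    qapp Q p (wedge (j c) (j e)) = c * e^`() - c^`() * e by exact: hQ.
have sz n : (n < 4)%N -> (size ('X^n : {poly R}) <= 4)%N by rewrite size_polyXn.
have sX : (size ('X : {poly R}) <= 4)%N by rewrite size_polyX.
have s1 : (size (1%R : {poly R}) <= 4)%N by rewrite size_poly1.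
rewrite [in LHS]WE [X in X = _]qappD [X in _ + X = _]qappD [X in _ + (_ + X) = _]qappD.
rewrite [X in _ + (_ + (_ + X)) = _]qappD [X in _ + (_ + (_ + (_ + X))) = _]qappD.
rewrite !qappZ !d ?sz //.
rewrite !derivXn derivX derivC /= -!mul_polyC.
ring.
Qed.

End Spinors.
End Forms.

(** * The Rumin operator and the connection induced from S *)

Section Derivatives.
Context {R : realType} {M : manifold5 R} {G : legendrean M}.
Implicit Types (p : frame G) (J : g2map G).

Lemma alt_anti (n : Hidx -> Hidx -> R) a b : alt n b a = - alt n a b.
Proof. by rewrite /alt opprB. Qed.

Lemma perp_anti (W : @form2 R) : (forall a b, W b a = - W a b) ->
  forall a b, perp W b a = - perp W a b.
Proof. by move=> hW a b; rewrite /perp hW levi_anti; ring. Qed.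

(** The contribution of [Pi] and [Sigma] to the Rumin operator; it is minus the
    partial torsion of the preferred connection, evaluated at [x]. *)
Definition obstruction_form (Pi : tfield G (wt BEd (-2) 2))
    (Sig : tfield G (wt BE 1 (-3))) p (x : Hidx -> R) : form2 :=
  fun a b => match a, b with
    | inl A, inl B => (\sum_C Pi p C * x (inr C)) * eps A B
    | inr A, inr B => (\sum_C Sig p C * x (inl C)) * eps A B
    | _, _ => 0
    end.

Lemma obstruction_form_anti Pi Sig p x a b :
  obstruction_form Pi Sig p x b a = - obstruction_form Pi Sig p x a b.
Proof.
have e (A B : 'I_2) : eps B A = - eps A B :> R by rewrite /eps; ring.
by case: a b => A [] B //=; rewrite ?oppr0 // e mulrN.
Qed.

(** The three components of the defining formula for [Pi] and [Sigma] are those of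
    an antisymmetrised derivative, apart from the obstruction terms. *)
Lemma d_perp_obstruction N D Pi Sig : weighted_extension N D ->
  obstructions D Pi Sig -> forall (w : tfield G BL1H), is_section w -> forall p a b,
  d_perp w p a b =
    perp (alt (fun a b => N w p (a, b))) a b + obstruction_form Pi Sig p (w p) a b.
Proof.
move=> [_ [hN _]] [_ _ hd] w sw p.
have {hd} [dEE dEF dFF] := hd w sw p; have Nl := fun a A => (hN w sw p a A).1;
  have Nr := fun a A => (hN w sw p a A).2.
have anti a b : d_perp w p b a = - d_perp w p a b by exact: d_perp_anti.
case=> A [] B.
- rewrite dEE /perp /alt /= mulr0 subr0 !Nl.
  move: A B; do 2 apply: I2P; rewrite !sumI2 !epsE; ring.
- rewrite dEF /perp /alt /= addr0 !Nl !Nr.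
  by congr (_ - _ / 2 * _); apply: eq_bigr => C _; rewrite Nl Nr.
- rewrite anti dEF (perp_anti (alt_anti _)) /= addr0; congr (- _).
  rewrite /perp /alt /= !Nl !Nr.
  by congr (_ - _ / 2 * _); apply: eq_bigr => C _; rewrite Nl Nr.
- rewrite dFF /perp /alt /= mulr0 subr0 !Nr.
  move: A B; do 2 apply: I2P; rewrite !sumI2 !epsE; ring.
Qed.

Lemma eq_kappa (u u' v v' : R) p : u = u' -> v = v' ->
  kappa G u v p tt = kappa G u' v' p tt.
Proof. by move=> -> ->. Qed.

(** The weight [[m-2,1-m]] is that of the [m]-th component of
    [Sym^3 S (Lambda^2 S)^-2]. *)
Definition cubic_density (m : nat) : tfield G (Bdens (m%:R - 2) (1 - m%:R)) :=
  kappa G (m%:R - 2) (1 - m%:R).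

Arguments cubic_density : clear implicits.

Lemma form_of1 (c : 'I_2 -> R) : @form_of _ 1 c = (c 0)%:P + (c 1) *: 'X.
Proof.
apply/polyP => i; rewrite coef_poly coefD coefC coefZ coefX.
case: i => [|[|i]] /=; rewrite ?mulr0 ?mulr1 ?addr0 ?add0r //.
  by rewrite insubT //; congr c; apply/val_inj.
by rewrite insubT //; congr c; apply/val_inj.
Qed.

Definition cubic_section J m : tfield G BL1H :=
  fun p a => cubic_density m p tt * japp J p 'X^m a.

Arguments cubic_section : clear implicits.

(** At [p] let [e0 = h0 (1,0)] and [e1 = h1 (0,1)] be the basis sections of [S],
    with [D e0 = h0 (P, P')] and [D e1 = h1 (S', S)].  The [m]-th component is the
    image of [e0^(3-m) e1^m]; the product rule and the twist by [(Lambda^2 S)^-2], on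
    which the connection form is [- 2 (P + S)], give the stated coefficients. *)
Lemma induced_cubic_section J (D : tfield G BS -> tfield G (Btens BL1H BS)) K p :
  induced_by_S J D K -> exists P P' S' S : Hidx -> R,
  forall m, (m < 4)%N -> is_section (cubic_section J m) -> forall a b,
  K (cubic_section J m) p (a, b) = cubic_density m p tt *
    (((1 - m%:R) * P a + (m%:R - 2) * S a) * japp J p 'X^m b
     + (3 - m%:R) * P' a * japp J p 'X^(m.+1) b
     + m%:R * S' a * japp J p 'X^(m.-1) b).
Proof.
move=> [_ hK].
pose h (j : 'I_2) q : R := kappa G j%:R (1 - j%:R) q tt.
have h0 j q : 0 < h j q by exact: kappa_gt0.
pose d (j i : 'I_2) (a : Hidx) := D (basisS j) p (a, i) / h j p.
exists (d 0 0), (d 0 1), (d 1 0), (d 1 1).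
have bE j q i : basisS j q i = (i == j)%:R * h i q by [].
have fE j q : @form_of _ 1 (basisS j q) = h j q *: 'X^j.
  rewrite form_of1 !bE; move: j; apply: I2P.
    by rewrite mul1r mul0r scale0r addr0 expr0 alg_polyC.
  by rewrite mul1r mul0r polyC0 add0r.
have dE j a : @form_of _ 1 (fun i => D (basisS j) p (a, i)) =
    h j p *: (d j 0 a *: 1 + d j 1 a *: 'X).
  rewrite form_of1 scalerDr !scalerA alg_polyC /d.
  by rewrite ![h j p * _]mulrC !divfK // lt0r_neq0.
have wE q : wedgeS (basisS 0 q) (basisS 1 q) = h 0 q * h 1 q.
  by rewrite /wedgeS !bE -![(_ == _)%:R]/(@kron R _ _) !kronE; ring.
have key (i1 i2 i3 : 'I_2) m : (i1 + i2 + i3)%N = m ->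
    is_section (cubic_section J m) -> forall a b,
  K (cubic_section J m) p (a, b) = cubic_density m p tt * (japp J p
     ((d i1 0 a *: 1 + d i1 1 a *: 'X) * 'X^(i2 + i3)
      + (d i2 0 a *: 1 + d i2 1 a *: 'X) * 'X^(i1 + i3)
      + (d i3 0 a *: 1 + d i3 1 a *: 'X) * 'X^(i1 + i2)) b
    - 2 * (d 0 0 a + d 1 1 a) * japp J p 'X^m b).
  move=> im sw a b.
  have kE q : h i1 q * h i2 q * h i3 q = cubic_density m q tt * (h 0 q * h 1 q) ^+ 2.
    rewrite expr2 /h /cubic_density -!kappaD -im !natrD.
    by apply: eq_kappa; rewrite /= modn_small //; ring.
  have e q c : japp J q (form_of (basisS i1 q) * form_of (basisS i2 q) *
      form_of (basisS i3 q)) c = cubic_section J m q c *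
      wedgeS (basisS 0 q) (basisS 1 q) ^+ 2.
    rewrite !fE wE /cubic_section [RHS]mulrAC -kE -jappZ -im; congr (japp J q _ c).
    by rewrite -!mul_polyC !polyCM !exprD; ring.
  have sb := @section_basisS _ _ G.
  have := hK _ _ _ _ _ _ (sb i1) (sb i2) (sb i3)
    (sb 0) (sb 1) sw e p a b.
  rewrite !fE !dE wE.
  have -> : wedgeS (fun i => D (basisS 0) p (a, i)) (basisS 1 p) +
      wedgeS (basisS 0 p) (fun i => D (basisS 1) p (a, i)) =
      h 0 p * h 1 p * (d 0 0 a + d 1 1 a).
    rewrite /wedgeS !bE -![(_ == _)%:R]/(@kron R _ _) !kronE /d.
    by field; rewrite !lt0r_neq0.
  set A := (X in japp J p X) ; have -> : A = (h i1 p * h i2 p * h i3 p) *: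
     ((d i1 0 a *: 1 + d i1 1 a *: 'X) * 'X^(i2 + i3)
      + (d i2 0 a *: 1 + d i2 1 a *: 'X) * 'X^(i1 + i3)
      + (d i3 0 a *: 1 + d i3 1 a *: 'X) * 'X^(i1 + i2)).
    by rewrite /A -!mul_polyC !polyCM !exprD; ring.
  rewrite jappZ kE /cubic_section => E.
  have H0 : (h 0 p * h 1 p) ^+ 2 != 0 by rewrite expf_neq0 // mulf_neq0 // lt0r_neq0.
  by apply: (mulIf H0); rewrite [RHS]mulrAC mulrBr E; ring.
have lin x y k b : japp J p ((x *: 1 + y *: 'X) * 'X^k) b =
    x * japp J p 'X^k b + y * japp J p 'X^(k.+1) b.
  by rewrite mulrDl -!scalerAl mul1r -exprS jappD !jappZ.
have [v0 v1] : (0 : 'I_2) = 0%N :> nat /\ (1 : 'I_2) = 1%N :> nat by [].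
case=> [|[|[|[|//]]]] _ sw a b.
- by rewrite (key 0 0 0) // !jappD !lin v0 /=; ring.
- by rewrite (key 0 0 1) // !jappD !lin v0 v1 /=; ring.
- by rewrite (key 0 1 1) // !jappD !lin v0 v1 /=; ring.
- by rewrite (key 1 1 1) // !jappD !lin v1 /=; ring.
Qed.
End Derivatives.

(** * The preferred connection on the four coordinate sections *)

Arguments cubic_density {R M G} m _ _.
Arguments cubic_section {R M G} J m _ _.
Arguments n0 {R M G} w u v _ _ _.
Arguments nd {R M G} w u v _ _ _.
Arguments nu {R M G} w u v _ _ _.

Section Nabla.
Context {R : realType} {M : manifold5 R} {G : legendrean M}.
Implicit Types (p : frame G) (J : g2map G).

Lemma section_cast (V : @bundle R) (u u' v v' : R) (s : tfield G (wt V u v)) :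
  u = u' -> v = v' -> @is_section _ _ G (wt V u v) s ->
  @is_section _ _ G (wt V u' v') s.
Proof. by move=> <- <-. Qed.

Lemma sectionZ (V : @bundle R) (k : R) (s : tfield G V) : is_section s ->
  @is_section _ _ G V (fun p i => k * s p i).
Proof.
move=> [st ss]; split=> [p p' g bp gp i|U fr oU sU i].
  by rewrite (st _ _ _ bp gp) mulr_sumr; apply: eq_bigr => j _; rewrite mulrCA.
by apply: smooth_onM => //; [exact: smooth_on_cst|exact: ss].
Qed.

Lemma nd_cast (D : weighted_ops G) (u u' v v' : R) (s : frame G -> 'I_2 -> R) :
  u = u' -> v = v' -> nd D u v s = nd D u' v' s.
Proof. by move=> <- <-. Qed.

Lemma nu_cast (D : weighted_ops G) (u u' v v' : R) (s : frame G -> 'I_2 -> R) :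
  u = u' -> v = v' -> nu D u v s = nu D u' v' s.
Proof. by move=> <- <-. Qed.

(** The connection form of the preferred connection on the density bundle
    [[m-2,1-m]], relative to the section [cubic_density m]. *)
Definition dlog_density (D : weighted_ops G) m p (a : Hidx) : R :=
  n0 D (m%:R - 2) (1 - m%:R) (cubic_density m) p (a, tt) / cubic_density m p tt.

Section Grad.
Variables (sigma : tfield G (Bdens 1 1)).
Variables (N : tfield G BL1H -> tfield G (Btens BL1H BL1H)) (D : weighted_ops G).
Hypotheses (hN : preferred sigma N) (hD : weighted_extension N D).

Lemma cubic_density_neq0 m p : cubic_density m p tt != 0 :> R.
Proof. by rewrite lt0r_neq0 // kappa_gt0. Qed.

(** The Leibniz rule for [cubic_density m * s], whose weight is that of [E^*]; the
    component along [F^*] vanishes since the preferred connection preserves [E^*]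
    inside [Lambda^1_H]. *)
Lemma nabla_cubic_Ed J m (k u v : R) (s : tfield G (wt BEd u v)) :
  is_section s -> m%:R - 2 + u = 0 -> 1 - m%:R + v = 0 ->
  (forall q A, japp J q 'X^m (inl A) = k * s q A) ->
  (forall q A, japp J q 'X^m (inr A) = 0) ->
  is_section (cubic_section J m) /\
  forall p a b, N (cubic_section J m) p (a, b) = cubic_density m p tt *
    (dlog_density D m p a * japp J p 'X^m b
     + if b is inl B then k * nd D u v s p (a, B) else 0).
Proof.
move=> ss eu ev Jl Jr.
pose t : tfield G (wt BEd 0 0) := fun q i => cubic_density m q tt * s q i.
have st : is_section t.
  by apply: (section_cast eu ev); apply: sectionM => //; exact: kappa_section.
have E : cubic_section J m = fun q a => k * embed_Ed t q a.
  apply/funext => q; apply/funext => -[] A; rewrite /cubic_section /embed_Ed.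
    by rewrite Jl mulrCA.
  by rewrite Jr !mulr0.
have sE := section_embed_Ed st.
have [pN split_N _ _ _] := hN; have [_ [eN [Leib _]]] := hD.
split=> [|p a b]; first by rewrite E; exact: sectionZ.
rewrite E partial_connectionZ //; case: b => B; last first.
  by rewrite (split_N _ sE).1 // Jr !mulr0 add0r mulr0.
rewrite (eN _ sE p a B).1 Jl.
rewrite -[nd D 0 0 _]/(nd D 0 0 t) -(nd_cast _ _ eu ev).
have [_ [ndM _]] := Leib _ _ u v _ (@kappa_section _ _ G (m%:R - 2) (1 - m%:R)).
rewrite [X in k * X](ndM _ ss p a B) /dlog_density /cubic_density.
by field; exact: cubic_density_neq0.
Qed.

Lemma nabla_cubic_Fd J m (k u v : R) (s : tfield G (wt BE u v)) :
  is_section s -> m%:R - 2 + u = -1 -> 1 - m%:R + v = -1 ->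
  (forall q A, japp J q 'X^m (inl A) = 0) ->
  (forall q A, japp J q 'X^m (inr A) = k * s q A) ->
  is_section (cubic_section J m) /\
  forall p a b, N (cubic_section J m) p (a, b) = cubic_density m p tt *
    (dlog_density D m p a * japp J p 'X^m b
     + if b is inr B then k * nu D u v s p (a, B) else 0).
Proof.
move=> ss eu ev Jl Jr.
pose t : tfield G (wt BE (-1) (-1)) := fun q i => cubic_density m q tt * s q i.
have st : is_section t.
  by apply: (section_cast eu ev); apply: sectionM => //; exact: kappa_section.
have E : cubic_section J m = fun q a => k * embed_Fd t q a.
  apply/funext => q; apply/funext => -[] A; rewrite /cubic_section /embed_Fd.
    by rewrite Jl !mulr0.
  by rewrite Jr mulrCA.
have sE := section_embed_Fd st.
have [pN split_N _ _ _] := hN; have [_ [eN [Leib _]]] := hD.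
split=> [|p a b]; first by rewrite E; exact: sectionZ.
rewrite E partial_connectionZ //; case: b => B.
  by rewrite (split_N _ sE).2 // Jl !mulr0 add0r mulr0.
rewrite (eN _ sE p a B).2 Jr.
rewrite -[nu D (-1) (-1) _]/(nu D (-1) (-1) t) -(nu_cast _ _ eu ev).
have [_ [_ nuM]] := Leib _ _ u v _ (@kappa_section _ _ G (m%:R - 2) (1 - m%:R)).
rewrite [X in k * X](nuM _ ss p a B) /dlog_density /cubic_density.
by field; exact: cubic_density_neq0.
Qed.

Lemma n0_kappaM (u v u' v' : R) p a :
  n0 D (u + u') (v + v') (kappa G (u + u') (v + v')) p (a, tt) =
  kappa G u v p tt * n0 D u' v' (kappa G u' v') p (a, tt)
  + n0 D u v (kappa G u v) p (a, tt) * kappa G u' v' p tt.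
Proof.
have [_ [_ [Leib _]]] := hD.
have [n0M _] := Leib u v u' v' _ (@kappa_section _ _ G u v).
rewrite -(n0M _ (@kappa_section _ _ G u' v')); congr (n0 D _ _ _ p (a, tt)).
by apply/funext => q; apply/funext => -[]; rewrite kappaD.
Qed.

Lemma dlog_kappaD (u v u' v' : R) p a :
  n0 D (u + u') (v + v') (kappa G (u + u') (v + v')) p (a, tt)
    / kappa G (u + u') (v + v') p tt =
  n0 D u v (kappa G u v) p (a, tt) / kappa G u v p tt +
  n0 D u' v' (kappa G u' v') p (a, tt) / kappa G u' v' p tt.
Proof.
have k0 x y : kappa G x y p tt != 0 by rewrite lt0r_neq0 // kappa_gt0.
by rewrite n0_kappaM kappaD; field; rewrite !k0.
Qed.

(** [kappa u v * kappa u' v' = kappa (u + u') (v + v')], so connection forms add,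
    and the weights of [cubic_density m] are affine in [m]. *)
Lemma dlog_density_midpoint m p a : dlog_density D m p a + dlog_density D m.+2 p a =
  2 * dlog_density D m.+1 p a.
Proof.
rewrite mulr2n mulrDl mul1r /dlog_density /cubic_density -!dlog_kappaD.
have e (u u' v v' : R) : u = u' -> v = v' ->
  n0 D u v (kappa G u v) p (a, tt) / kappa G u v p tt =
  n0 D u' v' (kappa G u' v') p (a, tt) / kappa G u' v' p tt by move=> -> ->.
by apply: e; rewrite -!natr1; ring.
Qed.

Lemma dlog_density_affine m p a : (m < 4)%N ->
  dlog_density D m p a =
    (m%:R - 1) * dlog_density D 2 p a + (2 - m%:R) * dlog_density D 1 p a.
Proof.
have e0 := dlog_density_midpoint 0 p a; have e1 := dlog_density_midpoint 1 p a.
case: m => [|[|[|[|//]]]] _; [|by ring|by ring|].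
  by rewrite -[LHS](addrK (dlog_density D 2 p a)) e0; ring.
by rewrite -[LHS](addKr (dlog_density D 1 p a)) e1; ring.
Qed.

Section Spinor.
Variables (o : tfield G (wt BEd 2 (-1))) (iota : tfield G (wt BE (-2) 1)).
Hypotheses (ho : is_section o) (hiota : is_section iota).
Let J := spinor_g2map o iota.
Local Notation r := (Num.sqrt (3 : R)).

(** The derivative of the [m]-th of the spinors [o_A], [- iota_A / r], [- o^A / r],
    [iota^A], as a section of [Lambda^1_H] tensor [Lambda^1_H] up to weight. *)
Definition spinor_nabla p m (a b : Hidx) : R :=
  match m, b with
  | 0%N, inl B => nd D 2 (-1) o p (a, B)
  | 1%N, inl B => - r^-1 * nd D 1 0 (lower iota) p (a, B)
  | 2%N, inr B => - r^-1 * nu D (-1) 0 (raise o) p (a, B)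
  | 3%N, inr B => nu D (-2) 1 iota p (a, B)
  | _, _ => 0
  end.

Lemma nabla_cubic_section m : (m < 4)%N ->
  is_section (cubic_section J m) /\
  forall p a b, N (cubic_section J m) p (a, b) = cubic_density m p tt *
    (dlog_density D m p a * japp J p 'X^m b + spinor_nabla p m a b).
Proof.
have slow : @is_section _ _ G (wt BEd 1 0) (lower iota).
  by apply: (section_cast _ _ (section_lower hiota)); ring.
have srai : @is_section _ _ G (wt BE (-1) 0) (raise o).
  by apply: (section_cast _ _ (section_raise ho)); ring.
have JE q A := @spinor_g2mapE _ _ _ o iota q A.
case: m => [|[|[|[|//]]]] _.
- have [sS gS] := nabla_cubic_Ed (J := J) (m := 0) (k := 1) ho ltac:(ring) ltac:(ring)
    ltac:(by move=> q A; case: (JE q A) => [[-> _ _ _] _]; rewrite mul1r)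
    ltac:(by move=> q A; case: (JE q A) => [_ []]).
  by split=> // p a [] B; rewrite gS ?mul1r.
- have [sS gS] := nabla_cubic_Ed (J := J) (m := 1) (k := - r^-1) slow ltac:(ring) ltac:(ring)
    ltac:(by move=> q A; case: (JE q A) => [[_ -> _ _] _]; rewrite mulNr mulrC)
    ltac:(by move=> q A; case: (JE q A) => [_ []]).
  by split=> // p a [] B; rewrite gS.
- have [sS gS] := nabla_cubic_Fd (J := J) (m := 2) (k := - r^-1) srai ltac:(ring) ltac:(ring)
    ltac:(by move=> q A; case: (JE q A) => [[]])
    ltac:(by move=> q A; case: (JE q A) => [_ [_ _ -> _]]; rewrite mulNr mulrC).
  by split=> // p a [] B; rewrite gS.
- have [sS gS] := nabla_cubic_Fd (J := J) (m := 3) (k := 1) hiota ltac:(ring) ltac:(ring)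
    ltac:(by move=> q A; case: (JE q A) => [[]])
    ltac:(by move=> q A; case: (JE q A) => [_ [_ _ _ ->]]; rewrite mul1r).
  by split=> // p a [] B; rewrite gS ?mul1r.
Qed.
End Spinor.
End Grad.
End Nabla.

(** * The torsion *)

Section Torsion.
Context {R : realType} {M : manifold5 R} {G : legendrean M}.
Implicit Types (p : frame G) (J : g2map G).

Lemma japp_surj J p (x : Hidx -> R) : G2_contact_structure J ->
  exists2 c : {poly R}, (size c <= 4)%N & x = japp J p c.
Proof.
move=> [_ /(_ p x)[c [cx _]] _]; exists (\poly_(i < 4) c (inord i)).
  exact: size_poly.
apply/funext => a; rewrite -cx; apply: eq_bigr => i _.
by rewrite coef_poly ltn_ord inord_val.
Qed.

Definition transvectant (c d : {poly R}) : {poly R} := c * d^`() - c^`() * d.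

(** The most general change of the connection induced on [J X^m] by a change of
    the connection on [S] by the 2 by 2 matrix of 1-forms with rows [(al, P')] and
    [(S', be)]. *)
Definition connection_change (al be P' S' : Hidx -> R) J p m (a b : Hidx) : R :=
  ((1 - m%:R) * al a + (m%:R - 2) * be a) * japp J p 'X^m b
  + (3 - m%:R) * P' a * japp J p 'X^(m.+1) b + m%:R * S' a * japp J p 'X^(m.-1) b.

(** For [al = J X^i] the sum in [sym7] is [X^(i+2)] times the alternating sum over
    [m], with binomial coefficients, of [(1 - m) (m - i)], of degree 2 in [m]; the
    other three 1-forms behave in the same way.  Replacing [X^i] by a cubic [c]
    that is kept abstract, with its derivative, the cancellation is a polynomial
    identity. *)
Lemma sym7_connection_change J p Q (al be P' S' : Hidx -> R) (f : {poly R} -> {poly R}) :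
  G2_contact_structure J -> sym4_projection J Q ->
  (forall m, (m < 4)%N ->
     f 'X^m = qapp Q p (alt (connection_change al be P' S' J p m))) ->
  sym7 f = 0.
Proof.
move=> hJ hQ hf.
have [ca sa ea] := japp_surj p al hJ; have [cb sb eb] := japp_surj p be hJ.
have [cP sP eP] := japp_surj p P' hJ; have [cS sS eS] := japp_surj p S' hJ.
have fE m : (m < 4)%N -> f 'X^m = (1 - m%:R) *: transvectant ca 'X^m +
    ((m%:R - 2) *: transvectant cb 'X^m + ((3 - m%:R) *: transvectant cP 'X^(m.+1)
    + m%:R *: transvectant cS 'X^(m.-1))).
  move=> m4; rewrite (hf _ m4).
  have -> : alt (connection_change al be P' S' J p m) = fun a b =>
      (1 - m%:R) * wedge (japp J p ca) (japp J p 'X^m) a b +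
      ((m%:R - 2) * wedge (japp J p cb) (japp J p 'X^m) a b +
      ((3 - m%:R) * wedge (japp J p cP) (japp J p 'X^(m.+1)) a b +
       m%:R * wedge (japp J p cS) (japp J p 'X^(m.-1)) a b)).
    apply/funext => a; apply/funext => b.
    by rewrite /alt /connection_change /wedge -ea -eb -eP -eS; ring.
  rewrite [LHS]qappD [X in _ + X = _]qappD [X in _ + (_ + X) = _]qappD !qappZ.
  have sz n : (n < 4)%N -> (size ('X^n : {poly R}) <= 4)%N by rewrite size_polyXn.
  congr (_ *: _ + (_ *: _ + (_ + _ *: _))); try by apply: hQ => //; exact: sz.
    (* for m = 3 the power X^4 is not a cubic, but its coefficient vanishes *)
    have [m3|m3] := ltnP m 3; first by congr (_ *: _); apply: hQ => //; exact: sz.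
    have -> : m = 3%N by apply/eqP; rewrite eqn_leq m3 -ltnS m4.
    by rewrite subrr !scale0r.
  by apply: hQ => //; apply: sz; exact: leq_ltn_trans (leq_pred m) m4.
have := (fE 0 isT, fE 1 isT, fE 2 isT, fE 3 isT).
rewrite expr0 expr1 => -[[[f0 f1] f2] f3].
have d1 : (1 : {poly R})^`() = 0 by rewrite -polyC1 derivC.
rewrite /sym7 f0 f1 f2 f3 /transvectant /= !derivXn derivX d1.
rewrite -!mul_polyC /=; ring.
Qed.

Section Spinors.
Variables (sigma : tfield G (Bdens 1 1)).
Variables (N : tfield G BL1H -> tfield G (Btens BL1H BL1H)) (D : weighted_ops G).
Variables (Pi : tfield G (wt BEd (-2) 2)) (Sig : tfield G (wt BE 1 (-3))).
Variables (o : tfield G (wt BEd 2 (-1))) (iota : tfield G (wt BE (-2) 1)).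
Let J := spinor_g2map o iota.
Local Notation r := (Num.sqrt (3 : R)).

(** The Rumin operator on the [m]-th spinor, before removing the Levi trace. *)
Definition spinor_form p m : form2 := fun a b =>
  alt (spinor_nabla D o iota p m) a b
  + obstruction_form Pi Sig p (japp J p 'X^m) a b.

Hypotheses (hN : preferred sigma N) (hD : weighted_extension N D).
Hypotheses (hPS : obstructions D Pi Sig) (ho : is_section o) (hi : is_section iota).

(** The partial torsion at [J X^m] is the connection of [S] minus the Rumin
    operator, applied to [cubic_section J m] and divided by [cubic_density m].  The
    connection forms of [S] and of the density combine into a
    [connection_change], which [sym7] annihilates. *)
Lemma torsion_spinor_form theta : G2_torsion J theta -> exists Q,
  sym4_projection J Q /\ forall p, theta p =
    - (qapp Q p (spinor_form p 3) - 3 *: 'X * qapp Q p (spinor_form p 2)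
       + 3 *: 'X^2 * qapp Q p (spinor_form p 1) - 'X^3 * qapp Q p (spinor_form p 0)).
Proof.
move=> [hJ [DS [K [T [Q [_ hK hT hQ thE]]]]]]; exists Q; split=> // p.
rewrite thE {theta thE}.
have [P [P' [S' [S KE]]]] := induced_cubic_section p hK.
have q0 : qapp Q p levi = 0 by case: hJ => _ _; apply.
set f := fun c => _.
pose al a := P a + dlog_density D 2 p a; pose be a := S a + dlog_density D 1 p a.
pose Z m := connection_change al be P' S' J p m.
have fE m : (m < 4)%N ->
    f 'X^m = qapp Q p (alt (Z m)) - qapp Q p (spinor_form p m).
  move=> m4; have [sw Ngrad] := nabla_cubic_section hN hD ho hi m4.
  have WE a b : \sum_d japp J p 'X^m d * T p d a b =
      perp (alt (Z m)) a b + (-1) * (perp (alt (spinor_nabla D o iota p m)) a b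
        + obstruction_form Pi Sig p (japp J p 'X^m) a b).
    apply: (mulfI (cubic_density_neq0 m p)); have := hT _ sw p a b.
    rewrite (d_perp_obstruction hD hPS sw) /nabla_perp.
    have -> : \sum_c cubic_section J m p c * T p c a b =
        cubic_density m p tt * \sum_d japp J p 'X^m d * T p d a b.
      by rewrite mulr_sumr; apply: eq_bigr => d _; rewrite /cubic_section mulrA.
    move=> ->.
    have oE : obstruction_form Pi Sig p (cubic_section J m p) a b =
        cubic_density m p tt * obstruction_form Pi Sig p (japp J p 'X^m) a b.
      rewrite /obstruction_form /cubic_section; case: a b => A [] B; rewrite ?mulr0 //;
      by rewrite mulrA mulr_sumr; congr (_ * _); apply: eq_bigr => C _; rewrite mulrCA.
    have pE (n n' n'' : Hidx -> Hidx -> R) :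
        (forall c d, n c d = cubic_density m p tt * (n' c d + n'' c d)) ->
        perp (alt n) a b = cubic_density m p tt * (perp (alt n') a b + perp (alt n'') a b).
      by move=> nE; rewrite /perp /alt !sumI2 !nE; ring.
    pose Kw c d := K (cubic_section J m) p (c, d).
    pose Nw c d := N (cubic_section J m) p (c, d).
    rewrite oE -[fun c d => K (cubic_section J m) p (c, d) - _]/(alt Kw).
    (* the connection form of the density occurs in both terms and cancels *)
    pose L c d := dlog_density D m p c * japp J p 'X^m d.
    rewrite (pE Kw (Z m) L) => [|c d]; last first.
      rewrite /Kw KE // /Z /connection_change /L /al /be (dlog_density_affine hD p c m4).
      by ring.
    rewrite (pE Nw L (spinor_nabla D o iota p m)) => [|c d]; last first.
      by rewrite /Nw Ngrad.
    by ring.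
  have -> : f 'X^m = qapp Q p (fun a b => perp (alt (Z m)) a b + (-1) *
      (perp (alt (spinor_nabla D o iota p m)) a b
        + obstruction_form Pi Sig p (japp J p 'X^m) a b)).
    by rewrite /f; congr (qapp Q p _); apply/funext => a; apply/funext.
  rewrite qappD qappZ [X in _ + _ *: X = _]qappD !(qapp_perp _ q0) -qappD scaleN1r.
  by [].
(* [sym7] only sees monomials, whose exponent is read off from their size *)
pose g (c : {poly R}) := qapp Q p (alt (Z (size c).-1)).
have g0 : sym7 g = 0.
  apply: (sym7_connection_change (J := J) (p := p) (Q := Q) (al := al) (be := be)
    (P' := P') (S' := S') hJ hQ) => m m4.
  by rewrite /g size_polyXn.
have := (fE 0 isT, fE 1 isT, fE 2 isT, fE 3 isT).
rewrite expr0 expr1 => -[[[f0 f1] f2] f3].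
move: g0; rewrite /sym7 /g !size_polyXn size_polyX size_poly1 /= f0 f1 f2 f3 => g0.
rewrite -[RHS]add0r -[X in _ = X + _]g0; ring.
Qed.
End Spinors.
End Torsion.

(** * The eight coefficients *)

Section Coefficients.
Context {R : realType} {M : manifold5 R} {G : legendrean M}.
Variables (sigma : tfield G (Bdens 1 1)).
Variables (N : tfield G BL1H -> tfield G (Btens BL1H BL1H)) (D : weighted_ops G).
Variables (Pi : tfield G (wt BEd (-2) 2)) (Sig : tfield G (wt BE 1 (-3))).
Variables (o : tfield G (wt BEd 2 (-1))) (iota : tfield G (wt BE (-2) 1)).
Let J := spinor_g2map o iota.
Local Notation r := (Num.sqrt (3 : R)).
Hypotheses (hN : preferred sigma N) (hD : weighted_extension N D).
Hypotheses (hPS : obstructions D Pi Sig) (ho : is_section o) (hi : is_section iota).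
Hypothesis hoi : forall p, \sum_A o p A * iota p A = 1.

(** Odd powers of [r] appear because [J X] and [J X^2] carry a factor [1 / r];
    writing [r ^+ 2] for every 3 makes each coefficient an identity of rational
    functions in [r]. *)
Lemma torsion_coefficients theta : G2_torsion J theta -> forall p, theta p =
  (r * psi0 Pi iota p)%:P + (r ^+ 2 * psi1 D Pi o iota p) *: 'X
  - (r ^+ 2 * psi5 D o iota p) *: 'X^2 - (r ^+ 3 * psi4 D o iota p) *: 'X^3
  - (r ^+ 3 * psi3 D o iota p) *: 'X^4 - (r ^+ 2 * psi2 D o iota p) *: 'X^5
  - (r ^+ 2 * psi6 D Sig o iota p) *: 'X^6 - (r * psi7 Sig o p) *: 'X^7.
Proof.
move=> hth; have [Q [hQ thE]] := torsion_spinor_form hN hD hPS ho hi hth.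
move=> p; rewrite thE.
have fanti m a b : spinor_form D Pi Sig o iota p m b a = - spinor_form D Pi Sig o iota p m a b.
  by rewrite /spinor_form (alt_anti _ a b) (obstruction_form_anti _ _ _ _ a b) -opprD.
have qE m := qapp_spinor (hoi p) hQ (fanti m); rewrite !qE.
have t2 : r ^+ 2 = 3 by rewrite sqr_sqrtr // ler0n.
have t0 : r != 0 by rewrite sqrtr_eq0 -ltNge ltr0n.
have pE (k a3 b3 c3 d3 e3 a2 b2 c2 d2 e2 a1 b1 c1 d1 e1 a0 b0 c0 d0 e0 : R) :
  let q a b c d e : {poly R} :=
    k *: a%:P + b *: 'X + c *: 'X^2 + d *: 'X^3 - e *: 'X^4 in
  - (q a3 b3 c3 d3 e3 - 3 *: 'X * q a2 b2 c2 d2 e2 + 3 *: 'X^2 * q a1 b1 c1 d1 e1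
     - 'X^3 * q a0 b0 c0 d0 e0) =
  (- (k * a3))%:P + (3 * (k * a2) - b3) *: 'X - (c3 - 3 * b2 + 3 * (k * a1)) *: 'X^2
  - (d3 - 3 * c2 + 3 * b1 - k * a0) *: 'X^3 - (3 * c1 - b0 - e3 - 3 * d2) *: 'X^4
  - (3 * e2 + 3 * d1 - c0) *: 'X^5 - (- d0 - 3 * e1) *: 'X^6 - e0 *: 'X^7.
  by rewrite /= -!mul_polyC; ring.
rewrite pE; congr (_%:P + _ *: _ - _ *: _ - _ *: _ - _ *: _ - _ *: _ - _ *: _ - _ *: _).
all: rewrite /psi0 /psi1 /psi2 /psi3 /psi4 /psi5 /psi6 /psi7 /contract /spinor_form /alt.
all: rewrite /spinor_nabla /obstruction_form /= !sumI2.
all: have [[L0 L1 L2 L3] [N0 N1 N2 N3]] := spinor_g2mapE o iota p 0.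
all: have [[K0 K1 K2 K3] [P0 P1 P2 P3]] := spinor_g2mapE o iota p 1.
all: rewrite ?expr0 ?expr1 ?L0 ?L1 ?L2 ?L3 ?N0 ?N1 ?N2 ?N3 ?K0 ?K1 ?K2 ?K3 ?P0 ?P1 ?P2 ?P3.
all: rewrite ?sumI2 ?epsE.
all: move: t2 t0; generalize r => t t2 t0; rewrite -?t2.
all: by field.
Qed.

Lemma octic_eq0 (a0 a1 a2 a3 a4 a5 a6 a7 : R) :
  a0%:P + a1 *: 'X - a2 *: 'X^2 - a3 *: 'X^3 - a4 *: 'X^4 - a5 *: 'X^5
    - a6 *: 'X^6 - a7 *: 'X^7 = 0 :> {poly R} ->
  [/\ a0 = 0, a1 = 0, a2 = 0 & a3 = 0] /\ [/\ a4 = 0, a5 = 0, a6 = 0 & a7 = 0].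
Proof.
move/polyP => E; do !split.
- by have := E 0%N; rewrite !coefE /= => <-; ring.
- by have := E 1%N; rewrite !coefE /= => <-; ring.
all: apply: oppr_inj; rewrite oppr0.
- by have := E 2%N; rewrite !coefE /= => <-; ring.
- by have := E 3%N; rewrite !coefE /= => <-; ring.
- by have := E 4%N; rewrite !coefE /= => <-; ring.
- by have := E 5%N; rewrite !coefE /= => <-; ring.
- by have := E 6%N; rewrite !coefE /= => <-; ring.
- by have := E 7%N; rewrite !coefE /= => <-; ring.
Qed.
End Coefficients.

Theorem mainTheorem1 (R : realType) (M : manifold5 R) (G : legendrean M)
    (sigma : tfield G (Bdens 1 1))
    (N : tfield G BL1H -> tfield G (Btens BL1H BL1H)) (D : weighted_ops G)
    (Pi : tfield G (wt BEd (-2) 2)) (Sig : tfield G (wt BE 1 (-3)))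
    (o : tfield G (wt BEd 2 (-1))) (iota : tfield G (wt BE (-2) 1))
    (theta : frame G -> {poly R})
    (hsigma : is_scale sigma)
    (hN : preferred sigma N)
    (hD : weighted_extension N D)
    (hPiSig : obstructions D Pi Sig)
    (ho : is_section o) (hiota : is_section iota)
    (hoi : forall p, \sum_A o p A * iota p A = 1)
    (htheta : G2_torsion (spinor_g2map o iota) theta) :
  (forall p, theta p = 0) <->
  (forall p,
     psi0 Pi iota p = 0 /\ psi1 D Pi o iota p = 0 /\
     psi2 D o iota p = 0 /\ psi3 D o iota p = 0 /\
     psi4 D o iota p = 0 /\ psi5 D o iota p = 0 /\
     psi6 D Sig o iota p = 0 /\ psi7 Sig o p = 0).
Proof.
have thE := torsion_coefficients hN hD hPiSig ho hiota hoi htheta.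
split=> [th0 p|psi_0 p]; last first.
  by rewrite thE; move: (psi_0 p) => [-> [-> [-> [-> [-> [-> [-> ->]]]]]]];
     rewrite !mulr0 !scale0r !subr0 addr0.
have r0 n : Num.sqrt (3 : R) ^+ n != 0.
  by rewrite expf_neq0 // sqrtr_eq0 -ltNge ltr0n.
have cancel n x : Num.sqrt (3 : R) ^+ n * x = 0 -> x = 0.
  by move/eqP; rewrite mulf_eq0 (negbTE (r0 n)) => /eqP.
have := th0 p; rewrite thE => /octic_eq0[].
move=> [/(cancel 1%N) -> /cancel -> /cancel -> /cancel ->].
by move=> [/cancel -> /cancel -> /cancel -> /(cancel 1%N) ->].
Qed.
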